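(* Let $X$ be a nonempty compact metrizable space, $T:X\to X$ a homeomorphism and $d\ge1$ an integer. Suppose that $(X,T)$ is an extension of an aperiodic dynamical system $(Z,S)$ with $Z$ compact metrizable of finite topological dimension and $S:Z\to Z$ a homeomorphism, and that $\mathrm{mdim}(X,T)<\frac{d}{16}$. Then $(X,T)$ embeds in the shift $(([0,1]^{d+1})^{\mathbb{Z}},\sigma)$.
   Context: For a finite open cover $\alpha$ of a space $Y$: $\mathrm{ord}(\alpha)=\sup_{y\in Y}\left(\sum_{U\in\alpha}\mathbf 1_U(y)\right)-1$; a cover $\beta$ refines $\alpha$ (written $\beta\succ\alpha$) if each element of $\beta$ is contained in some element of $\alpha$; $D(\alpha)=\min_{\beta\succ\alpha}\mathrm{ord}(\beta)$, over finite open covers $\beta$ of $Y$; the topological dimension is $\dim(Y)=\sup_\alpha D(\alpha)$ over finite open covers of $Y$. The join of two covers is $\alpha\vee\beta=(A\cap B)_{A\in\alpha,B\in\beta}$, and $\alpha_0^{n-1}=\alpha\vee T^{-1}(\alpha)\vee\cdots\vee T^{-(n-1)}(\alpha)$. The mean topological dimension is $\mathrm{mdim}(X,T)=\sup_\alpha\lim_{n\to\infty}\frac{D(\alpha_0^{n-1})}{n}$, over finite open covers $\alpha$ of $X$ (the limit exists by subadditivity). $(X,T)$ is an extension of $(Z,S)$ if there is a continuous surjection $\pi:X\to Z$ with $\pi\circ T=S\circ\pi$. A system is aperiodic if it has no periodic point. $\sigma$ is the bilateral shift $(x_i)_{i\in\mathbb{Z}}\mapsto(x_{i+1})_{i\in\mathbb{Z}}$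 on $([0,1]^{d+1})^{\mathbb{Z}}$ (product topology). A system $(X,T)$ embeds in $(Y,R)$ if there is a map $\phi:X\to Y$ that is a homeomorphism onto its image and satisfies $\phi\circ T=R\circ\phi$. *)

(* Defs.v *)
From HB Require Import structures.
From mathcomp Require Import all_boot all_order all_algebra.
From mathcomp Require Import all_classical all_reals all_analysis.

Set Implicit Arguments.
Unset Strict Implicit.
Unset Printing Implicit Defensive.

Import Order.TTheory GRing.Theory Num.Theory.
Import numFieldNormedType.Exports.

Local Open Scope classical_set_scope.
Local Open Scope ring_scope.

Section dynamics.
Context {X Y : topologicalType}.

Definition homeomorphism (f : X -> Y) : Prop :=
  exists g : Y -> X, [/\ cancel f g, cancel g f, continuous f & continuous g].

Definition is_extension (T : X -> X) (S : Y -> Y) : Prop :=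
  exists pi : X -> Y, [/\ continuous pi, range pi = setT & pi \o T = S \o pi].

Definition aperiodic (S : Y -> Y) : Prop :=
  forall (n : nat) (y : Y), (0 < n)%N -> iter n S y <> y.

End dynamics.

(* The type [range phi] carries the subspace topology of [Y]. *)
Definition homeomorphism_onto_image (X Y : topologicalType) (phi : X -> Y)
    : Prop :=
  exists2 h : X -> range phi, (forall x, set_val (h x) = phi x)
    & homeomorphism h.

Definition embeds (X Y : topologicalType) (T : X -> X) (S : Y -> Y) : Prop :=
  exists2 phi : X -> Y, homeomorphism_onto_image phi & phi \o T = S \o phi.

(* Finite covers are finite families, represented by lists: [ord] counts
   repeated members with multiplicity. *)
Section finite_open_covers.
Context {Y : topologicalType}.
Implicit Types a b : seq (set Y).

Definition open_cover a : Prop :=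
  (forall U, U \in a -> open U) /\ cover [set` a] id = setT.

Definition refines b a : Prop :=
  forall V, V \in b -> exists2 U, U \in a & V `<=` U.

Definition cover_join a b : seq (set Y) := [seq A `&` B | A <- a, B <- b].

(* [cover_iter T a n] is a \/ T^-1(a) \/ ... \/ T^-(n-1)(a); the trivial cover
   {Y} is the neutral element of the join. *)
Definition cover_iter (T : Y -> Y) a (n : nat) : seq (set Y) :=
  \big[cover_join/[:: setT]]_(k < n) [seq iter k T @^-1` U | U <- a].

End finite_open_covers.

Section dimension.
Context (R : realType) {Y : topologicalType}.
Local Open Scope ereal_scope.
Implicit Type a : seq (set Y).

Definition ord a : \bar R :=
  ereal_sup [set (\sum_(U <- a) \1_U y)%R%:E | y in [set: Y]] - 1.

(* When [Y] is nonempty and [a] is an open cover, the infimum is a minimum: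
   the values of [ord] on open covers are natural numbers, and [a] refines
   itself. *)
Definition cover_dim a : \bar R :=
  ereal_inf [set ord b | b in [set b | open_cover b /\ refines b a]].

End dimension.

Section topological_dimension.
Context (R : realType) (Y : topologicalType).
Local Open Scope ereal_scope.

Definition top_dim : \bar R :=
  ereal_sup [set cover_dim R a | a in @open_cover Y].

Definition mdim (T : Y -> Y) : \bar R :=
  ereal_sup
    [set limn (fun n : nat => cover_dim R (cover_iter T a n) * (n%:R^-1)%:E)
      | a in @open_cover Y].

End topological_dimension.

Definition cube (R : realType) (n : nat) : topologicalType :=
  {ptws 'I_n -> set_type (`[0%R, 1%R] : set R)}.

Definition shift_space (R : realType) (n : nat) : topologicalType :=
  {ptws int -> cube R n}.

Definition full_shift (R : realType) (n : nat) (x : shift_space R n)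
  : shift_space R n := fun i : int => x (i + 1).

(* Main.v *)
Require Import Defs.
From HB Require Import structures.
From mathcomp Require Import all_boot all_order all_algebra.
From mathcomp Require Import all_classical all_reals all_analysis.
From mathcomp Require Import ring lra zify.
Import Order.TTheory GRing.Theory Num.Theory.
Import numFieldNormedType.Exports.

Set Implicit Arguments.
Unset Strict Implicit.
Unset Printing Implicit Defensive.

Local Open Scope classical_set_scope.
Local Open Scope ring_scope.

(** Functions on X are perturbed into general position, in the style of Baire.
    Points of X in different fibres over Z are separated by one extra
    coordinate [h \o p], with [h] a generic real function on Z: as dim Z is
    finite, two distinct points z, w of Z can be separated by perturbing [h]
    along 2 (dim Z + 1) times at which their orbits do not meet (Jaworski).
    For points in the same fibre, a generic [h] also vanishes only finitely
    often along each orbit, which is what is needed to build markers in Z, and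
    from them a continuous [n : Z -> R] with [n (S z) = n z + 1] off a sparse
    set of times.  Along the blocks of times cut out by [n], a map
    [f : X -> R^d] is replaced by the coordinates of a generic map of X to the
    nerve of a cover of order < (length) * d / 16; both points see the same
    blocks, hence equal itineraries force them into a common member.
    The limit defining mdim exists because D is subadditive. *)

(** * Compactness and bump functions *)

(** A nerve map can be spread along orbits only if the points compared agree on where a block
    starts. Points of one fibre agree, since blocks are read off [Z]; points of different fibres
    need not, hence the extra coordinate. Two points are compared at a time, so the number of
    coordinates must reach the sum of two multiplicities; this is the source of a factor 2. Zeros
    matter because continuous markers decide by strict signs: a point where the function vanishes is
    neither marked nor unmarked and would block the greedy choice, and far enough along each orbit
    no such point remains. Each genericity claim is reduced to countably many conditions on compact
    sets of points or pairs, each open and locally dense, so that a single perturbation only has to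
    treat a small neighbourhood. *)

Lemma compact_set_ind (W : topologicalType) (K : set W) (P : set W -> Prop) :
  compact K -> P set0 -> (forall A B, A `<=` B -> P B -> P A) ->
  (forall A B, P A -> P B -> P (A `|` B)) ->
  (forall w, K w -> exists2 A, nbhs w A & P A) -> P K.
Proof.
move=> cK P0 PS PU Ploc; apply: contrapT => nPK.
(* If [P K] fails, the sets whose complement in [K] satisfies [P] form a proper filter; a cluster
   point of it in [K] contradicts the local hypothesis. *)
pose F : set_system W := [set B | P (K `\` B)].
have FF : ProperFilter F.
  split; first by rewrite /F /= setD0.
  split.
  - by rewrite /F /= setDT.
  - by move=> A B; rewrite /F /= => PA PB; rewrite setDIr; exact: PU.
  - by move=> A B AB; rewrite /F /=; apply: PS => x [Kx nB]; split=> // /AB.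
have [|w [Kw clw]] := cK F FF; first by rewrite /F /= setDv.
have [A Aw PA] := Ploc _ Kw.
have FA : F (~` A) by apply: PS PA => x [_ /contrapT].
by have [x []] := clw _ _ FA Aw.
Qed.

Section metric.
Context (R : realType) (X : metricType R).

Lemma continuous_lipschitz1 (f : X -> R) :
  (forall x y, `|f x - f y| <= mdist x y) -> continuous f.
Proof.
move=> fL x; apply/cvgrPdist_lt => e e0.
apply/nbhs_ballP; exists e => // y; rewrite ballEmdist /= => xy.
exact: le_lt_trans (fL _ _) xy.
Qed.

Lemma mdist_lip (z x y : X) : `|mdist z x - mdist z y| <= mdist x y.
Proof.
have := metric_triangle z x y; have := metric_triangle z y x.
by rewrite (metric_sym y x) ler_norml => ? ?; apply/andP; split; lra.
Qed.

Lemma continuous_mdist (z : X) : continuous (mdist z : X -> R).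
Proof. by apply: continuous_lipschitz1 => x y; exact: mdist_lip. Qed.

(* Capping by 1 keeps the set nonempty when [U] is the whole space. *)
Definition bump (U : set X) (x : X) : R :=
  inf ([set 1] `|` [set mdist x a | a in ~` U]).

Let bump_lb (U : set X) (x : X) : lbound ([set 1] `|` [set mdist x a | a in ~` U]) (0 : R).
Proof. by move=> _ [->|[a _ <-]]; [exact: ler01|exact: mdist_ge0]. Qed.

Let bump_has_inf (U : set X) (x : X) : has_inf ([set 1] `|` [set (mdist x a : R) | a in ~` U]).
Proof. by split; [exists 1; left | exists 0; exact: bump_lb]. Qed.

Lemma bump_ge0 U x : 0 <= bump U x.
Proof. by apply: lb_le_inf; [exists 1; left | exact: bump_lb]. Qed.

Lemma bump_lip U x y : `|bump U x - bump U y| <= mdist x y.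
Proof.
suff H u v : bump U u - mdist u v <= bump U v.
  by rewrite ler_norml; have := H x y; have := H y x;
     rewrite (metric_sym y x) => ? ?; apply/andP; split; lra.
apply: lb_le_inf; first by exists 1; left.
have duv := mdist_ge0 u v.
move=> _ [->|[a Ua <-]].
  suff : bump U u <= 1 by lra.
  by apply: ge_inf; [case: (bump_has_inf U u) | left].
have : bump U u <= mdist u a.
  by apply: ge_inf; [case: (bump_has_inf U u) | right; exists a].
have := metric_triangle u v a; lra.
Qed.

Lemma continuous_bump U : continuous (bump U).
Proof. exact/continuous_lipschitz1/bump_lip. Qed.

Lemma bump_gt0 U x : open U -> U x -> 0 < bump U x.
Proof.
move=> oU Ux; have /nbhs_ballP[r /= r0 rU] : nbhs x U by apply: open_nbhs_nbhs.
apply: (@lt_le_trans _ _ (Num.min 1 r)); first by rewrite lt_min ltr01.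
apply: lb_le_inf; first by exists 1; left.
move=> _ [->|[a Ua <-]]; first by rewrite ge_min lexx.
rewrite ge_min; apply/orP; right; rewrite leNgt; apply/negP => xa.
by apply: Ua; apply: rU; rewrite ballEmdist.
Qed.

Lemma bump_eq0 U x : ~ U x -> bump U x = 0.
Proof.
move=> Ux; apply/eqP; rewrite eq_le bump_ge0 andbT -(mdistxx x).
by apply: ge_inf; [case: (bump_has_inf U x) | right; exists x].
Qed.

Lemma bump_gt0E U x : open U -> 0 < bump U x <-> U x.
Proof.
move=> oU; split; last exact: bump_gt0.
by move=> h; apply: contrapT => /bump_eq0 E; rewrite E ltxx in h.
Qed.

End metric.

(** * General position *)

Lemma poly_nonroot_gt (R : realType) (q : {poly R}) (b : R) :
  q != 0 -> exists2 y, b < y & ~~ root q y.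
Proof.
move=> q0.
(* A nonzero polynomial has fewer than [size q] roots, so one of these candidates is not a root. *)
pose s := [seq b + i.+1%:R | i <- iota 0 (size q)].
have us : uniq s.
  rewrite map_inj_uniq ?iota_uniq// => i j /addrI /eqP.
  by rewrite eqr_nat => /eqP[].
have /allPn[y /mapP[i _ ->] ny] : ~~ all (root q) s.
  apply/negP => alls; have := max_poly_roots q0 alls us.
  by rewrite size_map size_iota ltnn.
by exists (b + i.+1%:R) => //; rewrite ltrDl ltr0n.
Qed.

(* The perturbation is [V / y] with [V] a Vandermonde matrix, so that each
   relevant minor is, up to a power of [y], a polynomial in [y] whose value
   at [0] is a Vandermonde determinant. *)
Lemma general_position (R : realType) (n m : nat) (p : 'I_n -> nat -> R)
    (e : R) : 0 < e ->
  exists v : 'I_n -> nat -> R,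
    (forall i l, (l < m)%N -> `|v i l - p i l| <= e) /\
    forall c : 'I_n -> R, (#|[pred i | c i != 0%R]| <= m)%N ->
      (forall l, (l < m)%N -> \sum_i c i * v i l = 0) -> forall i, c i = 0.
Proof.
move=> e0.
pose V (i : 'I_n) (l : nat) : R := i%:R ^+ l.
pose M (A : {set 'I_n}) : 'M[{poly R}]_(#|A|) :=
  \matrix_(a, l) ((V (enum_val a) l)%:P + (p (enum_val a) l)%:P * 'X).
have ME A y : (\det (M A)).[y] = \det (\matrix_(a < #|A|, l < #|A|)
     (V (enum_val a) l + p (enum_val a) l * y)).
  rewrite -/(horner_eval y _) -det_map_mx; congr (\det _).
  by apply/matrixP => a l; rewrite !mxE /= /horner_eval !hornerE.
have M0 A : \det (M A) != 0.
  apply/eqP => h; have := ME A 0; rewrite h horner0.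
  have -> : \matrix_(a < #|A|, l < #|A|)
       (V (enum_val a) l + p (enum_val a) l * 0)
     = (Vandermonde #|A| (\row_(a < #|A|) (enum_val a : 'I_n)%:R))^T :> 'M[R]_ _.
    by apply/matrixP => a l; rewrite !mxE mulr0 addr0.
  rewrite det_tr det_Vandermonde => /esym/eqP; apply/negP.
  apply/prodf_neq0 => i _; apply/prodf_neq0 => j ij.
  rewrite !mxE subr_eq0 eqr_nat; apply/eqP => /val_inj/enum_val_inj E.
  by rewrite E ltnn in ij.
pose B : R := \sum_(i < n) \sum_(l < m) `|V i l|.
have B0 : 0 <= B by rewrite !sumr_ge0// => i _; rewrite sumr_ge0.
have VB i l : (l < m)%N -> `|V i l| <= B.
  move=> lm; rewrite /B (bigD1 i)//= (bigD1 (Ordinal lm))//=.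
  rewrite -addrA lerDl addr_ge0// ?sumr_ge0// => j _.
  by rewrite sumr_ge0.
(* One product over all [A], since a single [y] must serve every support of [c]; taking it beyond
   [B / e] makes [V / y] at most [e]. *)
have Q0 : \prod_(A : {set 'I_n}) \det (M A) != 0 by apply/prodf_neq0.
have [y yB ny] := poly_nonroot_gt (B / e) Q0.
have y0 : 0 < y by apply: le_lt_trans yB; rewrite divr_ge0// ltW.
have yD A : (\det (M A)).[y] != 0.
  by move: ny; rewrite /root horner_prod => /prodf_neq0; apply.
exists (fun i l => p i l + V i l / y); split.
  move=> i l lm; rewrite addrC addKr normrM normfV (gtr0_norm y0).
  rewrite ler_pdivrMr// (le_trans (VB i l lm))// mulrC -ler_pdivrMr//.
  exact: ltW.
move=> c cm sc i.
apply: contrapT => /eqP ci.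
pose A := finset (fun i => c i != 0).
pose cA : 'rV[R]_(#|A|) := \row_a c (enum_val a).
pose N : 'M[R]_(#|A|) :=
  \matrix_(a < #|A|, l < #|A|) (V (enum_val a) l + p (enum_val a) l * y).
have uN : N \in unitmx by rewrite unitmxE unitfE -ME.
have cN : cA *m N = 0.
  apply/rowP => l; rewrite !mxE.
  have lm : (l < m)%N by by rewrite (leq_trans (ltn_ord l))// /A cardsE.
  (* Scaling by [y] turns [p + V / y] into the entries [V + p * y] of [N]. *)
  have : y * \sum_i c i * (p i l + V i l / y) = 0 by rewrite sc ?mulr0.
  rewrite (bigID (mem A)) /= [X in _ + X]big1 ?addr0; last first.
    by move=> j; rewrite inE negbK => /eqP ->; rewrite mul0r.
  rewrite big_enum_val/= mulr_sumr => E; rewrite -[RHS]E.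
  apply: eq_bigr => a _; rewrite !mxE.
  by field; rewrite gt_eqF.
have cA0 : cA = 0 by rewrite -(mulmxK uN cA) cN mul0mx.
have iA : i \in A by rewrite inE.
have := congr1 (fun u : 'rV[R]_(#|A|) => u 0 (enum_rank_in iA i)) cA0.
by rewrite !mxE enum_rankK_in// => /eqP; rewrite (negbTE ci).
Qed.

(** * Maps to the nerve of a cover *)

Lemma continuous_bigsum (R : realType) (T : topologicalType) (I : Type)
    (r : seq I) (Q : pred I) (f : I -> T -> R) :
  (forall i, continuous (f i)) ->
  continuous (fun x => \sum_(i <- r | Q i) f i x).
Proof.
move=> cf x; elim: r => [|i r IH].
  under eq_fun do rewrite big_nil; exact: cvg_cst.
under eq_fun do rewrite big_cons.
case: (Q i) => //.
by apply: cvgD => //; exact: cf.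
Qed.

Definition mult (X : Type) (b : seq (set X)) (x : X) : nat :=
  count (fun U => `[< U x >]) b.

Lemma multE (X : Type) (b : seq (set X)) (x : X) :
  mult b x = #|[pred i : 'I_(size b) | `[< nth set0 b i x >]]|.
Proof.
by rewrite /mult -sum1_count (big_nth set0) big_mkord sum1_card.
Qed.

Section partition_of_unity.
Context (R : realType) (X : metricType R) (b : seq (set X)).
Hypothesis cb : open_cover b.

Local Notation U i := (nth set0 b i).

Let oU (i : 'I_(size b)) : open (U i).
Proof. by case: cb => + _; apply; exact: mem_nth. Qed.

Definition punity_den (x : X) : R := \sum_(i < size b) bump (U i) x.
Definition punity (i : 'I_(size b)) (x : X) : R := bump (U i) x / punity_den x.

Lemma punity_den_gt0 x : 0 < punity_den x.
Proof.
case: cb => _ cT; have : [set: X] x by [].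
rewrite -cT => -[V /= Vb Vx].
have ib : (index V b < size b)%N by rewrite index_mem.
rewrite /punity_den (bigD1 (Ordinal ib)) //= nth_index//.
rewrite ltr_wpDr// ?sumr_ge0// => [i _|]; first exact: bump_ge0.
by apply: bump_gt0 => //; case: cb => + _; apply.
Qed.

Lemma continuous_punity i : continuous (punity i).
Proof.
move=> x; apply: cvgM; first exact: continuous_bump.
apply: cvgV; first by rewrite gt_eqF// punity_den_gt0.
by apply: continuous_bigsum => j; exact: continuous_bump.
Qed.

Lemma punity_ge0 i x : 0 <= punity i x.
Proof. by rewrite divr_ge0 ?bump_ge0// ltW// punity_den_gt0. Qed.

Lemma punity_gt0 i x : 0 < punity i x <-> U i x.
Proof.
by rewrite pmulr_lgt0 ?invr_gt0 ?punity_den_gt0//; exact: bump_gt0E.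
Qed.

Lemma punity_neq0 i x : (punity i x != 0) = `[< U i x >].
Proof.
apply/idP/asboolP => [h|/punity_gt0/lt0r_neq0//].
by apply/punity_gt0; rewrite lt0r h punity_ge0.
Qed.

Lemma sum_punity x : \sum_i punity i x = 1.
Proof. by rewrite -mulr_suml divff// gt_eqF// punity_den_gt0. Qed.

Lemma card_punity x : #|[pred i | punity i x != 0]| = mult b x.
Proof. by rewrite multE; apply: eq_card => i; rewrite !inE punity_neq0. Qed.

(* [F] is the canonical map to the nerve of [b] followed by a generic
   simplexwise affine map to R^L. *)
Lemma cover_map (L : finType) (phi : L -> X -> R) (e : R) :
  0 < e ->
  (forall V x y l, V \in b -> V x -> V y -> `|phi l x - phi l y| <= e) ->
  exists F : L -> X -> R, [/\ forall l, continuous (F l),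
    forall l x, `|F l x - phi l x| <= e + e,
    forall x y, (mult b x + mult b y <= #|L|)%N ->
      (forall l, F l x = F l y) -> exists2 V, V \in b & V x /\ V y &
    forall x, (mult b x <= #|L|)%N -> exists l, F l x != 0].
Proof.
move=> e0 osc.
have /choice[p pP] (i : 'I_(size b)) : exists p : L -> R,
    forall x l, U i x -> `|p l - phi l x| <= e.
  have [[y Uy]|nU] := pselect (exists y, U i y).
    exists (phi ^~ y) => x l Ux; apply: osc Uy Ux; exact: mem_nth.
  by exists (fun=> 0) => x l Ux; exfalso; apply: nU; exists x.
pose p' i k := if insub k is Some o then p i (enum_val (o : 'I_#|L|)) else 0.
have [v [vp vi]] := general_position #|L| p' e0.
pose F (l : L) x := \sum_i punity i x * v i (enum_rank l).
(* The weights sum to 1, so they are not all 0; independence of the vertices is linear, not just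
   affine, and therefore excludes a common zero. *)
have F0 x : (mult b x <= #|L|)%N -> exists l, F l x != 0.
  move=> bx; apply: contrapT => nl.
  have /vi c0 : (#|[pred i | punity i x != 0%R]| <= #|L|)%N by rewrite card_punity.
  have := sum_punity x; rewrite big1 => [/esym/eqP|i _]; first by rewrite oner_eq0.
  apply: (c0 _ i) => l lL; apply: contrapT => /eqP ne; apply: nl.
  by exists (enum_val (Ordinal lL)); rewrite /F enum_valK.
exists F; split => //.
- move=> l; apply: continuous_bigsum => i x; apply: cvgM; last exact: cvg_cst.
  exact: continuous_punity.
- move=> l x; rewrite -[phi l x]mul1r -(sum_punity x) mulr_suml -sumrB.
  rewrite -[leRHS]mul1r -(sum_punity x) mulr_suml.
  apply: (le_trans (ler_norm_sum _ _ _)); apply: ler_sum => i _.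
  rewrite -mulrBr normrM ger0_norm ?punity_ge0//.
  have [->|] := eqVneq (punity i x) 0; first by rewrite !mul0r.
  rewrite punity_neq0 => /asboolP Ux.
  apply: ler_wpM2l; first exact: punity_ge0.
  apply: (le_trans (ler_distD (p i l) _ _)); apply: lerD; last exact: pP.
  by have := vp i (enum_rank l) (ltn_ord _); rewrite /p' valK enum_rankK.
- move=> x y xy Fxy.
  (* The difference of the two weight vectors is supported on the members containing [x] or [y], at
     most [#|L|] of them, so general position applies. *)
  have c0 i : punity i x - punity i y = 0.
    apply: (vi (fun i => punity i x - punity i y)) => [|l lL]; last first.
      have := Fxy (enum_val (Ordinal lL)); rewrite /F enum_valK /= => E.
      under eq_bigr do rewrite mulrBl.
      by rewrite sumrB E subrr.
    apply: leq_trans xy; rewrite -!card_punity.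
    rewrite -cardUI (leq_trans _ (leq_addr _ _))//; apply: subset_leq_card.
    apply/fintype.subsetP => j; rewrite !inE; apply: contraTT.
    by rewrite negb_or !negbK => /andP[/eqP -> /eqP ->]; rewrite subrr.
  have [i Ui] : exists i, punity i x != 0.
    apply: contrapT => ni; have := sum_punity x.
    rewrite big1 => [/esym/eqP|i _]; first by rewrite oner_eq0.
    by apply: contrapT => /eqP ne; apply: ni; exists i.
  exists (U i); first exact: mem_nth.
  move/eqP: (c0 i); rewrite subr_eq0 => /eqP E.
  by split; apply/asboolP; rewrite -punity_neq0 -?E.
Qed.

End partition_of_unity.

(** * Open dense sets of functions *)

Lemma small_cover (R : realType) (X : metricType R) (L : finType)
    (phi : L -> X -> R) (e r : R) :
  compact [set: X] -> (forall l, continuous (phi l)) -> 0 < e -> 0 < r ->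
  exists2 b : seq (set X), open_cover b & forall V x y, V \in b -> V x -> V y ->
    mdist x y < r /\ forall l, `|phi l x - phi l y| <= e.
Proof.
move=> cX cphi e0 r0.
pose small (V : set X) := forall x y, V x -> V y ->
    mdist x y < r /\ forall l, `|phi l x - phi l y| <= e.
have [b [ob bs bT]] : exists b : seq (set X), [/\ forall V, V \in b -> open V,
    forall V, V \in b -> small V &
    [set: X] `<=` [set x | exists2 V, V \in b & V x]]; last first.
  exists b; last by move=> V x y Vb; exact: bs.
  split=> //; apply/seteqP; split => // x _.
pose P (A : set X) := exists b : seq (set X), [/\ forall V, V \in b -> open V,
    forall V, V \in b -> small V &
    A `<=` [set x | exists2 V, V \in b & V x]].
apply: (@compact_set_ind _ _ P cX).
- by exists [::]; split.
- by move=> A B AB [b [ob bs bB]]; exists b; split=> // x /AB/bB.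
- move=> A B [b [ob bs bB]] [b' [ob' bs' bB']]; exists (b ++ b'); split.
  + by move=> V; rewrite mem_cat => /orP[/ob|/ob'].
  + by move=> V; rewrite mem_cat => /orP[/bs|/bs'].
  + move=> x [/bB|/bB'] [V Vb Vx]; exists V => //=; rewrite mem_cat Vb//.
    by rewrite orbT.
- move=> x _.
  have Hphi : \forall y \near x, forall l, `|phi l x - phi l y| < e / 2.
    by apply: filter_forall => l; apply/cvgr_dist_lt; rewrite ?divr_gt0//; exact: cphi.
  have Hd : \forall y \near x, mdist x y < r / 2.
    apply/nbhs_ballP; exists (r / 2); first by rewrite /= divr_gt0.
    by rewrite ballEmdist.
  have : nbhs x [set y | (forall l, `|phi l x - phi l y| < e / 2)
     /\ mdist x y < r / 2] by exact: filterI.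
  rewrite nbhsE => -[V [oV Vx] VH].
  exists V; first by exists V.
  exists [:: V]; split => [W|W|y Vy]; try by rewrite inE => /eqP ->.
    rewrite inE => /eqP -> y z /VH[y1 y2] /VH[z1 z2]; split.
      rewrite (le_lt_trans (metric_triangle _ x _))// metric_sym.
      by rewrite (splitr r) ltrD.
    move=> l; rewrite (le_trans (ler_distD (phi l x) _ _))// (splitr e).
    by rewrite lerD// ltW// distrC.
  by exists V; rewrite // inE.
Qed.

Section function_families.
Context (R : realType) (X : topologicalType) (d : nat).
Implicit Types f g : 'I_d -> X -> R.
Implicit Types G H : ('I_d -> X -> R) -> Prop.

Definition cfam f := forall c, continuous (f c).
(** Uniform closeness, pointwise and non-strict; with [cfam] as a side condition it stands in for
    the metric of a function space. *)
Definition close (e : R) f g := forall c x, `|g c x - f c x| <= e.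
Definition isopen G := forall f, cfam f -> G f ->
  exists2 e, 0 < e & forall g, cfam g -> close e f g -> G g.
Definition isdense G := forall f e, cfam f -> 0 < e ->
  exists g, [/\ cfam g, close e f g & G g].

Lemma closeW e e' f g : e <= e' -> close e f g -> close e' f g.
Proof. by move=> ee fg c x; exact: le_trans (fg c x) ee. Qed.

Lemma close_trans e e' f g h :
  close e f g -> close e' g h -> close (e + e') f h.
Proof.
move=> fg gh c x; rewrite (le_trans (ler_distD (g c x) _ _))// addrC.
by rewrite lerD.
Qed.

(** Move [f] towards each [G i] with weight [th i]. Where one weight is 1 the others vanish, as
    their sum is at most 1, so the new value is exactly that of [G i]. *)
Lemma perturb (I : finType) f (th : I -> X -> R) (G : I -> 'I_d -> X -> R) e :
  cfam f -> (forall i, continuous (th i)) -> (forall i, cfam (G i)) ->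
  (forall i x, 0 <= th i x) -> (forall x, \sum_i th i x <= 1) -> 0 <= e ->
  (forall i c x, th i x != 0 -> `|G i c x - f c x| <= e) ->
  exists g, [/\ cfam g, close e f g &
    forall i x, th i x = 1 -> forall c, g c x = G i c x].
Proof.
move=> cf cth cG th0 th1 e0 Gf.
exists (fun c x => f c x + \sum_i th i x * (G i c x - f c x)); split.
- move=> c x; apply: cvgD; first exact: cf.
  apply: continuous_bigsum => i y; apply: cvgM; first exact: cth.
  by apply: cvgB; [exact: cG | exact: cf].
- move=> c x; rewrite addrC addKr (le_trans (ler_norm_sum _ _ _))//.
  apply: (@le_trans _ _ (\sum_i th i x * e)); last first.
    by rewrite -mulr_suml ler_piMl.
  apply: ler_sum => i _; rewrite normrM ger0_norm//.
  have [->|ne] := eqVneq (th i x) 0; first by rewrite !mul0r.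
  by apply: ler_wpM2l => //; exact: Gf.
- move=> i x thi c; rewrite (bigD1 i)//= big1 => [|j ji].
    by rewrite thi mul1r addr0 addrC subrK.
  suff -> : th j x = 0 by rewrite mul0r.
  apply/eqP; rewrite eq_le th0 andbT.
  have := th1 x; rewrite (bigD1 i)//= thi (bigD1 j)//=.
  have : 0 <= \sum_(k | (k != i) && (k != j)) th k x by rewrite sumr_ge0.
  by lra.
Qed.

(* The limit is the common point of nested closed balls, obtained pointwise as
   a supremum, so completeness of C(X, R^d) is not needed. *)
Lemma isdense_bigcap (G : nat -> ('I_d -> X -> R) -> Prop) :
  (forall n, isopen (G n)) -> (forall n, isdense (G n)) ->
  isdense (fun f => forall n, G n f).
Proof.
move=> oG dG f0 e0 cf0 e0_gt0.
pose S := {fe : ('I_d -> X -> R) * R | cfam fe.1 /\ 0 < fe.2}.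
(* Halving makes the balls nested, and the bound [n.+1%:R^-1] on the radii makes the convergence
   uniform. *)
pose rel (n : nat) (s t : S) := [/\ close ((sval s).2 / 2) (sval s).1 (sval t).1,
  (sval t).2 <= (sval s).2 / 2, (sval t).2 <= n.+1%:R^-1 &
  forall g, cfam g -> close (sval t).2 (sval t).1 g -> G n g].
have /choice[nxt nxtP] (ns : nat * S) : exists t, rel ns.1 ns.2 t.
  case: ns => n [[f e] [/= cf epos]].
  have [//||g [cg fg Gg]] := dG n f (e / 2); first by rewrite divr_gt0.
  have [h h0 hG] := oG n g cg Gg.
  pose e' := Num.min (e / 2) (Num.min h (n.+1%:R^-1)).
  have e'0 : 0 < e' by rewrite !lt_min divr_gt0// h0 invr_gt0 ltr0n.
  exists (exist _ (g, e') (conj cg e'0)); split=> //=.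
  - by rewrite ge_min lexx.
  - by rewrite !ge_min lexx !orbT.
  - by move=> k ck gk; apply: hG => //; apply: closeW gk; rewrite !ge_min lexx orbT.
pose s := fix s n : S := if n is m.+1 then nxt (m, s m)
  else exist (fun fe : ('I_d -> X -> R) * R => cfam fe.1 /\ 0 < fe.2) (f0, e0) (conj cf0 e0_gt0).
pose F n := (sval (s n)).1; pose E n := (sval (s n)).2.
have cF n : cfam (F n) by case: (svalP (s n)).
have E0 n : 0 < E n by case: (svalP (s n)).
have sP n : rel n (s n) (s n.+1) by exact: (nxtP (n, s n)).
have step n : [/\ close (E n / 2) (F n) (F n.+1), E n.+1 <= E n / 2,
    E n.+1 <= n.+1%:R^-1 & forall g, cfam g -> close (E n.+1) (F n.+1) g -> G n g].
  by have [] := sP n.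
have lo n k c x : F n c x - E n <= F (n + k)%N c x - E (n + k)%N.
  elim: k => [|k IH]; first by rewrite addn0.
  rewrite (le_trans IH)// addnS; have [+ h _ _] := step (n + k)%N.
  by move=> /(_ c x); rewrite ler_norml => /andP[? ?]; lra.
have hi n k c x : F (n + k)%N c x + E (n + k)%N <= F n c x + E n.
  elim: k => [|k IH]; first by rewrite addn0.
  rewrite (le_trans _ IH)// addnS; have [+ h _ _] := step (n + k)%N.
  by move=> /(_ c x); rewrite ler_norml => /andP[? ?]; lra.
have lohi n k c x : F n c x - E n <= F k c x + E k.
  have := lo n k c x; have := hi k n c x; rewrite (addnC k n).
  by have := E0 (n + k)%N; lra.
pose f c x := sup [set F n c x - E n | n in [set: nat]].
have fF n : close (E n) (F n) f.
  move=> c x; rewrite /close ler_distl; apply/andP; split.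
    apply: ub_le_sup; last by exists n.
    by exists (F n c x + E n) => _ [k _ <-].
  apply: ge_sup; first by exists (F 0%N c x - E 0%N), 0%N.
  by move=> _ [k _ <-].
have cf : cfam f.
  move=> c x; apply/cvgrPdist_le => e epos.
  have [n ne] : exists n, E n <= e / 3.
    have [|n nlt] := @ltr_add_invr R 0 (e / 3); first by rewrite divr_gt0.
    exists n.+1; rewrite add0r in nlt.
    by have [_ _ h _] := step n; exact: le_trans h (ltW nlt).
  have : \forall y \near x, `|F n c x - F n c y| <= e / 3.
    by apply/cvgr_dist_le; rewrite ?divr_gt0//; exact: cF.
  apply: filterS => y; have := fF n c x; have := fF n c y.
  by rewrite !ler_norml => /andP[? ?] /andP[? ?] /andP[? ?]; apply/andP; split; lra.
exists f; split => //; first exact: (fF 0%N).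
by move=> n; have [_ _ _] := step n; apply.
Qed.

Lemma isopenI G H : isopen G -> isopen H -> isopen (fun f => G f /\ H f).
Proof.
move=> oG oH f cf [Gf Hf]; have [e e0 eG] := oG f cf Gf.
have [r r0 rH] := oH f cf Hf; exists (Num.min e r); first by rewrite lt_min e0.
move=> g cg fg; split; [apply: eG|apply: rH] => //; apply: closeW fg.
  by rewrite ge_min lexx.
by rewrite ge_min lexx orbT.
Qed.

Lemma isdenseI G H : isopen G -> isdense G -> isdense H ->
  isdense (fun f => G f /\ H f).
Proof.
move=> oG dG dH f e cf e0.
have [//||g [cg fg Gg]] := dG f (e / 2); first by rewrite divr_gt0.
have [r r0 rG] := oG g cg Gg.
have [//||h [ch gh Hh]] := dH g (Num.min r (e / 2)).
  by rewrite lt_min r0 divr_gt0.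
exists h; split => //.
  rewrite (splitr e); apply: close_trans fg _; apply: closeW gh.
  by rewrite ge_min lexx orbT.
by split=> //; apply: rG => //; apply: closeW gh; rewrite ge_min lexx.
Qed.

Context (W : topologicalType).
Implicit Types (K : set W) (P : ('I_d -> X -> R) -> W -> Prop).

(** Joint in the function and the point, so that a compact set of points admits one common
    radius. *)
Definition jointly_open P := forall f w, cfam f -> P f w ->
  exists2 e, 0 < e & exists2 A, nbhs w A &
    forall g v, cfam g -> close e f g -> A v -> P g v.

Lemma isopen_compact K P : compact K -> jointly_open P ->
  isopen (fun f => forall w, K w -> P f w).
Proof.
move=> cK oP f cf Pf.
pose Q (A : set W) := exists2 e, 0 < e &
   forall g, cfam g -> close e f g -> forall w, A w -> P g w.
suff [e e0 H] : Q K by exists e.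
apply: compact_set_ind cK _ _ _ _.
- by exists 1.
- by move=> A B AB [e e0 H]; exists e => // g cg fg w /AB; exact: H.
- move=> A B [e e0 H] [r r0 H']; exists (Num.min e r); first by rewrite lt_min e0.
  move=> g cg fg w [Aw|Bw]; [apply: H|apply: H'] => //; apply: closeW fg.
    by rewrite ge_min lexx.
  by rewrite ge_min lexx orbT.
- move=> w Kw; have [e e0 [A Aw H]] := oP f w cf (Pf w Kw).
  by exists A => //; exists e => // g cg fg v Av; exact: H.
Qed.

(** Finitely many of the given neighbourhoods cover [K]; over each the condition is open by
    compactness and dense by hypothesis, and finite intersections of open dense sets are dense. *)
Lemma isdense_compact K P : compact K -> jointly_open P ->
  (forall w, K w -> exists A, [/\ nbhs w A, compact A &
     isdense (fun f => forall w, A w -> P f w)]) ->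
  isdense (fun f => forall w, K w -> P f w).
Proof.
move=> cK oP dP.
(* Openness over a set need not pass to its subsets, hence the larger [B]. *)
pose Q (A : set W) := exists2 B, A `<=` B & isopen (fun f => forall w, B w -> P f w)
   /\ isdense (fun f => forall w, B w -> P f w).
have [B KB [_ dB]] : Q K.
  apply: compact_set_ind cK _ _ _ _.
  - exists set0 => //; split; first by move=> f cf _; exists 1.
    by move=> f e cf e0; exists f; split=> // c x; rewrite subrr normr0 ltW.
  - by move=> A B AB [C BC HC]; exists C => //; exact: subset_trans BC.
  - move=> A B [A' AA' [oA dA]] [B' BB' [oB dB]]; exists (A' `|` B').
      by move=> x [/AA'|/BB']; [left|right].
    have := isopenI oA oB; have := isdenseI oA dA dB.
    have -> : (fun f => (forall w, A' w -> P f w) /\ (forall w, B' w -> P f w))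
       = (fun f => forall w, (A' `|` B') w -> P f w).
      apply/funext => f; apply/propext; split.
        by move=> [hA hB] w [/hA|/hB].
      by move=> h; split=> w ?; apply: h; [left|right].
    by [].
  - move=> w Kw; have [A [Aw cA dA]] := dP w Kw; exists A => //; exists A => //.
    by split=> //; exact: isopen_compact.
move=> f e cf e0; have [g [cg fg Bg]] := dB f e cf e0.
by exists g; split=> // w /KB; exact: Bg.
Qed.

End function_families.

(** * Perturbation along finitely many times *)

Lemma iter_cancel (A : Type) (f g : A -> A) n :
  cancel f g -> cancel (iter n f) (iter n g).
Proof.
by move=> fg; elim: n => // n IH x; rewrite iterSr iterS fg IH.
Qed.

Lemma continuous_iter (X : topologicalType) (f : X -> X) n :
  continuous f -> continuous (iter n f).
Proof.
move=> cf; elim: n => [|n IH] x; first exact: cvg_id.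
by apply: (@continuous_comp _ _ _ (iter n f) f); [exact: IH | exact: cf].
Qed.

Lemma sum_le1 (R : realType) (I : finType) (th : I -> R) :
  (forall i, th i <= 1) -> (forall i j, th i != 0 -> th j != 0 -> i = j) ->
  \sum_i th i <= 1.
Proof.
move=> th1 thu; have [[i thi]|ni] := pselect (exists i, th i != 0).
  rewrite (bigD1 i)//= big1 ?addr0// => j ji.
  by apply: contrapT => /eqP thj; move/eqP: ji; apply; exact: thu.
rewrite big1 ?ler01// => i _; apply: contrapT => /eqP thi.
by apply: ni; exists i.
Qed.

Definition clamp01 (R : realType) (x : R) : R := Num.max 0 (Num.min 1 x).

Section clamp.
Context (R : realType).
Implicit Type x : R.

Lemma clamp01_ge0 x : 0 <= clamp01 x. Proof. by rewrite le_max lexx. Qed.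
Lemma clamp01_le1 x : clamp01 x <= 1.
Proof. by rewrite ge_max ler01 ge_min lexx. Qed.
Lemma clamp01_id1 x : 1 <= x -> clamp01 x = 1.
Proof. by move=> x1; rewrite /clamp01 min_l// max_r. Qed.
Lemma clamp01_gt0 x : (0 < clamp01 x) = (0 < x).
Proof. by rewrite lt_max ltxx lt_min ltr01. Qed.
Lemma clamp01_neq0 x : (clamp01 x != 0) = (0 < x).
Proof. by rewrite -clamp01_gt0 lt0r clamp01_ge0 andbT. Qed.

Lemma continuous_minr (T : topologicalType) (f g : T -> R) :
  continuous f -> continuous g -> continuous (fun t => Num.min (f t) (g t)).
Proof. by move=> cf cg t; have := continuous_min (cf t) (cg t). Qed.

Lemma continuous_maxr (T : topologicalType) (f g : T -> R) :
  continuous f -> continuous g -> continuous (fun t => Num.max (f t) (g t)).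
Proof. by move=> cf cg t; have := continuous_max (cf t) (cg t). Qed.

Lemma continuous_clamp01 (T : topologicalType) (f : T -> R) :
  continuous f -> continuous (fun t => clamp01 (f t)).
Proof.
by move=> cf; apply: continuous_maxr; [|apply: continuous_minr => //];
  move=> t; exact: cvg_cst.
Qed.
End clamp.

(** Phrased by multiplicity, which is the order plus one: on a nonempty space this is D(a) < k. *)
Definition refinable (X : topologicalType) (a : seq (set X)) (k : nat) :=
  exists b, [/\ open_cover b, refines b a & forall x, (mult b x <= k)%N].

Definition dim_lt (X : topologicalType) (D : nat) :=
  forall a : seq (set X), open_cover a -> refinable a D.

Section local_perturbation.
Context (R : realType) (Z : metricType R) (T T' : Z -> Z) (D : nat).
Hypotheses (cZ : compact [set: Z]) (dimZ : dim_lt Z D).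
Hypotheses (TK : cancel T T') (T'K : cancel T' T).
Hypotheses (cT : continuous T) (cT' : continuous T').

(** Around the base points moved to time [t i], [f] is replaced by coordinate [i] of a nerve map
    approximating the values of [f] at the times [t]. Only different times need disjoint places: at
    a common time both base points use the same coordinate. The radius is chosen before [f], [e] and
    [dl], as density over a fixed neighbourhood requires. *)
Lemma local_perturbation (pt : bool -> Z) (k : nat) (t : 'I_k -> nat) :
  (forall i j a b, i != j -> iter (t i) T (pt a) <> iter (t j) T (pt b)) ->
  exists2 r : R, 0 < r &
  forall (f : 'I_1 -> Z -> R) e dl, cfam f -> 0 < e -> 0 < dl ->
  exists g, [/\ cfam g, close e f g,
    (D <= k)%N -> forall x a, mdist (pt a) x <= r ->
      exists i, g 0 (iter (t i) T x) <> 0 &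
    (D + D <= k)%N -> forall x y a b, mdist (pt a) x <= r -> mdist (pt b) y <= r ->
      dl <= mdist x y -> exists i, g 0 (iter (t i) T x) <> g 0 (iter (t i) T y)].
Proof.
move=> dis.
have near_pt a : \forall u \near pt a, forall i j b, i != j ->
    mdist (iter (t i) T (pt a)) (iter (t i) T u) <
    mdist (iter (t i) T (pt a)) (iter (t j) T (pt b)) / 2.
  apply: filter_forall => i; apply: filter_forall => j; apply: filter_forall => b.
  have [->|ij] := eqVneq i j; first by apply: nearW => u /eqP.
  have c0 : 0 < mdist (iter (t i) T (pt a)) (iter (t j) T (pt b)) / 2.
    by rewrite divr_gt0// mdist_gt0; apply/eqP/dis.
  have := @continuous_iter _ _ (t i) cT (pt a) _ (nbhsx_ballx _ _ c0).
  rewrite ballEmdist => h.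
  have : \forall u \near pt a, mdist (iter (t i) T (pt a)) (iter (t i) T u) <
    mdist (iter (t i) T (pt a)) (iter (t j) T (pt b)) / 2 by exact: h.
  by apply: filterS.
have /choice[rho rhoP] a : exists r : R, 0 < r /\ forall u, mdist (pt a) u < r ->
    forall i j b, i != j -> mdist (iter (t i) T (pt a)) (iter (t i) T u) <
    mdist (iter (t i) T (pt a)) (iter (t j) T (pt b)) / 2.
  have /nbhs_ballP[r /= r0 rH] := near_pt a; exists r; split => // u ur.
  by apply: rH; rewrite ballEmdist.
pose r1 := Num.min (rho true) (rho false).
have r1_gt0 : 0 < r1 by rewrite lt_min !(proj1 (rhoP _)).
have r1_rho a : r1 <= rho a by case: a; rewrite ge_min lexx ?orbT.
have sep u v a b i j : mdist (pt a) u < r1 -> mdist (pt b) v < r1 ->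
    iter (t i) T u = iter (t j) T v -> i = j.
  move=> ua vb uv; apply/eqP/negPn/negP => ij.
  have H1 := (rhoP a).2 u (lt_le_trans ua (r1_rho a)) i j b ij.
  rewrite eq_sym in ij.
  have H2 := (rhoP b).2 v (lt_le_trans vb (r1_rho b)) j i a ij.
  have := metric_triangle (iter (t i) T (pt a)) (iter (t i) T u) (iter (t j) T (pt b)).
  rewrite {2}uv [X in _ <= _ + X]metric_sym.
  rewrite (metric_sym (iter (t j) T (pt b)) (iter (t i) T (pt a))) in H2.
  by move: H1 H2; lra.
pose mm z : R := Num.min (mdist (pt true) z) (mdist (pt false) z).
have mmP z a : mm z <= mdist (pt a) z by case: a; rewrite ge_min lexx ?orbT.
have mmP' z : exists a, mm z = mdist (pt a) z.
  by rewrite /mm; case: leP => _; [exists true | exists false].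
have cmm : continuous mm.
  by apply: continuous_minr; exact: continuous_mdist.
(* Equal to 1 within [r1 / 2] of a base point and to 0 from distance [r1] on. *)
pose th0 z := clamp01 (2 - mm z * (2 / r1)).
have cth0 : continuous th0.
  apply: continuous_clamp01 => z; apply: cvgB; first exact: cvg_cst.
  by apply: cvgM; [exact: cmm | exact: cvg_cst].
have th0_neq0 z : th0 z != 0 -> mm z < r1.
  rewrite clamp01_neq0 subr_gt0 mulrA ltr_pdivrMr// mulrC; lra.
pose th (i : 'I_k) z := th0 (iter (t i) T' z).
have thT i z : th i (iter (t i) T z) = th0 z by rewrite /th iter_cancel.
exists (r1 / 2); first by rewrite divr_gt0.
move=> f e dl cf e0 dl0.
have e20 : 0 < e / 2 by rewrite divr_gt0.
pose phi (i : 'I_k) x := f 0 (iter (t i) T x).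
have cphi i : continuous (phi i).
  move=> x; apply: (@continuous_comp _ _ _ (iter (t i) T) (f 0)).
    exact: continuous_iter.
  exact: cf.
have [al cal alP] := small_cover cZ cphi e20 dl0.
have [b [cb bal bD]] := dimZ cal.
have bP V x y : V \in b -> V x -> V y ->
    mdist x y < dl /\ forall i, `|phi i x - phi i y| <= e / 2.
  by move=> /bal[U Ua VU] /VU Ux /VU Uy; exact: alP Ua Ux Uy.
have [F [cF Fphi Finj Fn0]] := cover_map cb e20
  (fun V x y l Vb Vx Vy => (bP V x y Vb Vx Vy).2 l).
have [||||||g [cg fg gG]] := @perturb R Z 1 'I_k f th (fun i _ x => F i (iter (t i) T' x)) e cf.
- move=> i x; apply: (@continuous_comp _ _ _ (iter (t i) T') th0).
    exact: continuous_iter.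
  exact: cth0.
- move=> i c x; apply: (@continuous_comp _ _ _ (iter (t i) T') (F i)).
    exact: continuous_iter.
  exact: cF.
- by move=> i x; exact: clamp01_ge0.
- move=> x; apply: sum_le1 => [i|i j]; first exact: clamp01_le1.
  move=> /th0_neq0 + /th0_neq0.
  have [a ->] := mmP' (iter (t i) T' x); have [c ->] := mmP' (iter (t j) T' x).
  by move=> ax cx; apply: sep ax cx _; rewrite !(iter_cancel _ T'K).
- exact: ltW.
- move=> i c x _; rewrite (ord1 c).
  have -> : f 0 x = phi i (iter (t i) T' x) by rewrite /phi iter_cancel.
  by rewrite [leRHS](splitr e) Fphi.
have gF i x a : mdist (pt a) x <= r1 / 2 -> g 0 (iter (t i) T x) = F i x.
  move=> ax; rewrite (gG i) ?iter_cancel// thT /th0 clamp01_id1//.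
  suff : mm x * (2 / r1) <= 1 by lra.
  rewrite mulrA ler_pdivrMr// mul1r; have := mmP x a; lra.
exists g; split => //.
- move=> Dk x a ax; have [|i Fi] := Fn0 x; first by rewrite card_ord (leq_trans (bD x)).
  by exists i; rewrite (gF i x a)//; exact/eqP.
- move=> Dk x y a c ax cy xy; apply: contrapT => ni.
  have [||V Vb [Vx Vy]] := Finj x y.
  + by rewrite card_ord (leq_trans _ Dk)// leq_add.
  + move=> i; apply: contrapT => ne; apply: ni; exists i.
    by rewrite (gF i x a)// (gF i y c).
  by have [] := bP V x y Vb Vx Vy; rewrite ltNge xy.
Qed.

End local_perturbation.

(** * Generic functions on a finite-dimensional aperiodic system *)

Section jointly_open.
Context (R : realType) (X : topologicalType) (d : nat) (W : topologicalType).

(** The bound [e + e] allows [L] to be a difference of two values. With [e] a quarter of [|L f w|],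
    changing [f] loses at most a half and moving [w] less than a quarter. *)
Lemma jointly_open_neq0 (L : ('I_d -> X -> R) -> W -> R) :
  (forall f, cfam f -> continuous (L f)) ->
  (forall f g e w, close e f g -> `|L g w - L f w| <= e + e) ->
  jointly_open (fun f w => L f w <> 0).
Proof.
move=> cL LL f w cf Lf0.
have e0 : 0 < `|L f w| / 4 by rewrite divr_gt0// normr_gt0; exact/eqP.
exists (`|L f w| / 4) => //.
exists [set v | `|L f w - L f v| < `|L f w| / 4].
  by apply/cvgr_dist_lt => //; exact: cL.
move=> g v cg fg /= vw gv0.
have := LL f g _ v fg; have := ler_distD (L f v) (L f w) 0.
by move: vw; rewrite gv0 !subr0 sub0r normrN; lra.
Qed.

Lemma jointly_open_ex (I : Type) (P : I -> ('I_d -> X -> R) -> W -> Prop) :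
  (forall i, jointly_open (P i)) -> jointly_open (fun f w => exists i, P i f w).
Proof.
move=> oP f w cf [i Pi]; have [e e0 [A Aw H]] := oP i f w cf Pi.
by exists e => //; exists A => // g v cg fg Av; exists i; exact: H.
Qed.

End jointly_open.

Section orbits.
Context (R : realType) (X : metricType R).

Lemma compact_mdist_le (z : X) (r : R) :
  compact [set: X] -> compact [set x | mdist z x <= r].
Proof.
move=> cX; apply: (subclosed_compact _ cX) => //.
exact: (closed_comp (fun x _ => @continuous_mdist R X z x) (@closed_le R r)).
Qed.

Lemma nbhs_mdist_le (z : X) (r : R) : 0 < r -> nbhs z [set x | mdist z x <= r].
Proof.
by move=> r0; apply/nbhs_ballP; exists r => // x; rewrite ballEmdist => /ltW.
Qed.

Lemma continuous_mdist2 : continuous (fun p : X * X => mdist p.1 p.2).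
Proof.
move=> [x y]; apply/cvgrPdist_lt => e e0.
have e20 : 0 < e / 2 by rewrite divr_gt0.
exists (ball x (e / 2), ball y (e / 2)) => /=.
  by split; exact: nbhsx_ballx.
move=> [u v] [/=]; rewrite !ballEmdist /= => xu yv.
have := mdist_lip x y v; have := mdist_lip v x u.
rewrite (metric_sym v x) (metric_sym v u) !ler_norml => /andP[? ?] /andP[? ?].
by rewrite ltr_norml; apply/andP; split; lra.
Qed.

Context (T : X -> X).
Hypotheses (injT : injective T) (aT : aperiodic T).

Lemma iter_eq_shift i j u v : iter i T u = iter j T v -> (i <= j)%N ->
  u = iter (j - i) T v.
Proof.
elim: i j => [|i IH] [|j] //=; rewrite ?subn0//.
by move=> /injT h ij; rewrite subSS; exact: IH.
Qed.

Lemma aperiodic_iter_inj i j u : iter i T u = iter j T u -> i = j.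
Proof.
wlog ij : i j / (i <= j)%N => [H|] E.
  by case/orP: (leq_total i j) => /H; [apply|move=> h; exact/esym/h].
have /esym := iter_eq_shift E ij.
have [ji _|ji] := leqP j i; first by apply/eqP; rewrite eqn_leq ij.
by move=> h; case: (aT (n := (j - i)%N) (y := u)) => //; rewrite subn_gt0.
Qed.

(** With times [2 * i * k] the iterates sit at positions [(2 * i + e) * k] of one orbit with [e]
    equal to 0 or 1, and [2 * i + e] determines [i]. *)
Lemma separating_times_orbit (pt : bool -> X) z k M : (0 < k)%N ->
  (forall a, pt a = z \/ pt a = iter k T z) ->
  exists t : 'I_M -> nat, forall i j a b, i != j ->
    iter (t i) T (pt a) <> iter (t j) T (pt b).
Proof.
move=> k0 pz; exists (fun i => (i.*2 * k)%N) => i j a b ij.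
have ptE c : exists e : bool, pt c = iter (e * k) T z.
  by case: (pz c) => ->; [exists false | exists true; rewrite mul1n].
have [e ->] := ptE a; have [e' ->] := ptE b.
rewrite -!iterD -!mulnDl => /aperiodic_iter_inj /eqP.
rewrite eqn_pmul2r// => /eqP E; move/eqP: ij; apply; apply: val_inj.
by move: E; clear; case: e e' => -[] /=; lia.
Qed.

(** If neither point is a forward iterate of the other, injectivity keeps their forward orbits
    disjoint and any distinct times do; otherwise both lie on one orbit. *)
Lemma separating_times (pt : bool -> X) M : pt true <> pt false ->
  exists t : 'I_M -> nat, forall i j a b, i != j ->
    iter (t i) T (pt a) <> iter (t j) T (pt b).
Proof.
move=> ptne.
have [[a [k E]]|nE] := pselect (exists a k, pt a = iter k T (pt (~~ a))).
  apply: (@separating_times_orbit pt (pt (~~ a)) k).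
    by case: k E => // E; exfalso; apply: ptne; case: a E.
  by move=> b; case: (eqVneq a b) E => [-> ->|]; [right|case: a b => -[]//; left].
exists val => i j a b ij E.
have [ab|ab] := eqVneq a b.
  by rewrite ab in E; move/aperiodic_iter_inj: E => /val_inj /eqP; rewrite (negbTE ij).
have {}ab : b = ~~ a by case: a b ab {E} => -[].
rewrite ab in E; apply: nE; case/orP: (leq_total i j) => ij'.
  by exists a, (j - i)%N; exact: iter_eq_shift.
by exists (~~ a), (i - j)%N; rewrite negbK; exact: iter_eq_shift.
Qed.

End orbits.

Section generic_functions.
Context (R : realType) (Z : metricType R) (T T' : Z -> Z) (D : nat).
Hypotheses (cZ : compact [set: Z]) (dimZ : dim_lt Z D).
Hypotheses (TK : cancel T T') (T'K : cancel T' T).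
Hypotheses (cT : continuous T) (cT' : continuous T') (aT : aperiodic T).

Let injT : injective T := can_inj TK.

Lemma continuous_orbit d (f : 'I_d -> Z -> R) c n :
  cfam f -> continuous (fun z => f c (iter n T z)).
Proof.
move=> cf x; apply: (@continuous_comp _ _ _ (iter n T) (f c)).
  exact: continuous_iter.
exact: cf.
Qed.

Lemma jointly_open_nonzero_times (s : seq nat) :
  jointly_open (fun (f : 'I_1 -> Z -> R) z =>
    exists t, t \in s /\ f 0 (iter t T z) <> 0).
Proof.
apply: jointly_open_ex => t; case: (boolP (t \in s)) => [ts|nts]; last first.
  by move=> f w cf [].
move=> f w cf [_ ft].
have [||e e0 [A Aw H]] :=
  @jointly_open_neq0 R Z 1 Z (fun f z => f 0 (iter t T z)) _ _ f w cf ft.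
- by move=> g cg; exact: continuous_orbit.
- move=> g h e z gh; rewrite (le_trans (gh _ _))// lerDl.
  exact: le_trans (gh 0 z).
by exists e => //; exists A => // g v cg fg Av; split=> //; exact: H.
Qed.

(** Both base points are taken to be [z]: aperiodicity separates distinct times, and [D] coordinates
    suffice for a nerve map without zeros. *)
Lemma isdense_nonzero_times (s : seq nat) : uniq s -> (D <= size s)%N ->
  isdense (fun f : 'I_1 -> Z -> R => forall z, [set: Z] z ->
    exists t, t \in s /\ f 0 (iter t T z) <> 0).
Proof.
move=> us Ds; apply: isdense_compact => //; first exact: jointly_open_nonzero_times.
move=> z _.
have [|r r0 H] := @local_perturbation R Z T T' D cZ dimZ TK T'K cT cT'
    (fun=> z) (size s) (fun i => nth 0%N s i).
  move=> i j _ _ ij /(aperiodic_iter_inj injT aT)/eqP.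
  by rewrite nth_uniq// => /eqP/val_inj/eqP; rewrite (negbTE ij).
exists [set x | mdist z x <= r]; split.
- exact: nbhs_mdist_le.
- exact: compact_mdist_le.
- move=> f e cf e0; have [g [cg fg Hg _]] := H f e 1 cf e0 ltr01.
  exists g; split=> // x zx; have [i gi] := Hg Ds x true zx.
  by exists (nth 0%N s i); split; [exact: mem_nth|].
Qed.

Lemma infinite_times (Q : nat -> Prop) n : (forall K, exists2 t, (K <= t)%N & Q t) ->
  exists s, [/\ uniq s, size s = n & forall t, t \in s -> Q t].
Proof.
move=> QI; elim: n => [|n [s [us sn Qs]]]; first by exists [::].
have [t tK Qt] := QI (\max_(u <- s) u).+1.
exists (t :: s); split; rewrite /= ?sn ?us ?andbT//.
  apply/negP => ts; have := @leq_bigmax_seq _ s xpredT id t ts isT.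
  by rewrite leqNgt tK.
by move=> u; rewrite inE => /orP[/eqP ->|/Qs].
Qed.

(** There are countably many lists of [D] distinct times, and being nonzero at one of them from
    every starting point is open and dense. Infinitely many zeros on an orbit would supply a list
    that violates this. *)
Lemma isdense_eventually_nonzero :
  isdense (fun f : 'I_1 -> Z -> R => forall z,
    exists K, forall n, (K <= n)%N -> f 0 (iter n T z) <> 0).
Proof.
(* Codes that do not denote [D] distinct times impose nothing. *)
pose G (n : nat) (f : 'I_1 -> Z -> R) := if unpickle n is Some s then
  uniq (s : seq nat) -> size s = D -> forall z, [set: Z] z ->
    exists t, t \in s /\ f 0 (iter t T z) <> 0 else True.
have triv (H : ('I_1 -> Z -> R) -> Prop) : (forall f, H f) -> isopen H /\ isdense H.
  move=> HT; split; first by move=> f _ _; exists 1.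
  by move=> f e cf e0; exists f; split=> // c x; rewrite subrr normr0 ltW.
have GP n : isopen (G n) /\ isdense (G n).
  rewrite /G; case: (unpickle n) => [s|]; last exact: triv.
  have [[us sD]|ns] := pselect (uniq s /\ size s = D); last first.
    by apply: triv => f us sD; case: ns.
  have oG : isopen (fun f : 'I_1 -> Z -> R => forall z, [set: Z] z ->
      exists t, t \in s /\ f 0 (iter t T z) <> 0).
    by apply: isopen_compact => //; exact: jointly_open_nonzero_times.
  split.
    by move=> f cf Gf; have [e e0 H] := oG f cf (Gf us sD); exists e => // g cg /H h _ _;
       exact: h.
  move=> f e cf e0.
  have [|g [cg fg Hg]] := @isdense_nonzero_times s us _ f e cf e0; first by rewrite sD.
  by exists g.
move=> f e cf e0.
have [n|n|g [cg fg Gg]] := @isdense_bigcap R Z 1 G _ _ f e cf e0;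
  [exact: (GP n).1 | exact: (GP n).2 |].
exists g; split => // z; apply: contrapT => nK.
have [|s [us sD gs]] := @infinite_times (fun t => g 0 (iter t T z) = 0) D.
  move=> K; apply: contrapT => h; apply: nK; exists K => n Kn gn.
  by apply: h; exists n.
have := Gg (pickle s); rewrite /G pickleK => /(_ us sD z I)[t [ts]].
by apply; exact: gs.
Qed.

(** The pairs of distinct points are exhausted by the compact sets [K n]; near each pair, a nerve
    map read at [D + D] separating times tells the points apart. *)
Lemma isdense_separating :
  isdense (fun f : 'I_1 -> Z -> R => forall z w, z <> w ->
    exists n, f 0 (iter n T z) <> f 0 (iter n T w)).
Proof.
pose P (f : 'I_1 -> Z -> R) (p : Z * Z) :=
  exists n, f 0 (iter n T p.1) - f 0 (iter n T p.2) <> 0.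
pose K n := [set p : Z * Z | n.+1%:R^-1 <= mdist p.1 p.2 :> R].
have oP : jointly_open P.
  apply: jointly_open_ex => n; apply: jointly_open_neq0.
  - move=> f cf p; apply: cvgB.
      apply: (@continuous_comp _ _ _ fst (fun z => f 0 (iter n T z))).
        exact: cvg_fst.
      exact: continuous_orbit.
    apply: (@continuous_comp _ _ _ snd (fun z => f 0 (iter n T z))).
      exact: cvg_snd.
    exact: continuous_orbit.
  - move=> f g e p fg; have := fg 0 (iter n T p.1); have := fg 0 (iter n T p.2).
    rewrite !ler_norml => /andP[? ?] /andP[? ?]; apply/andP; split; lra.
have cK n : compact (K n).
  have cZZ : compact [set: Z * Z] by rewrite -setXTT; exact: compact_setX.
  apply: (subclosed_compact _ cZZ) => //.
  exact: (closed_comp (fun x _ => @continuous_mdist2 R Z x) (@closed_ge R _)).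
have dK n : isdense (fun f => forall p, K n p -> P f p).
  apply: isdense_compact => // -[z w] /= Kzw.
  pose dl := mdist z w / 2.
  have zw : 0 < mdist z w by apply: lt_le_trans Kzw; rewrite invr_gt0 ltr0n.
  have dl0 : 0 < dl by rewrite divr_gt0.
  pose pt b := if b then z else w.
  have ptne : pt true <> pt false by apply/eqP; rewrite -mdist_gt0.
  have [t tP] := separating_times injT aT (D + D) ptne.
  have [r r0 H] := @local_perturbation R Z T T' D cZ dimZ TK T'K cT cT' pt _ t tP.
  (* Moving each point by at most a quarter of [mdist z w] keeps them at least [dl] apart. *)
  pose q := Num.min r (mdist z w / 4).
  have q0 : 0 < q by rewrite lt_min r0 divr_gt0.
  exists ([set x | mdist z x <= q] `*` [set x | mdist w x <= q]); split.
  - exists ([set x | mdist z x <= q], [set x | mdist w x <= q]) => //.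
    by split; exact: nbhs_mdist_le.
  - by apply: compact_setX; exact: compact_mdist_le.
  - move=> f e cf e0; have [g [cg fg _ Hg]] := H f e dl cf e0 dl0.
    exists g; split=> // -[x y] [/= zx wy].
    have zx4 : mdist z x <= mdist z w / 4 by rewrite (le_trans zx)// ge_min lexx orbT.
    have wy4 : mdist w y <= mdist z w / 4 by rewrite (le_trans wy)// ge_min lexx orbT.
    have zxr : mdist z x <= r by rewrite (le_trans zx)// ge_min lexx.
    have wyr : mdist w y <= r by rewrite (le_trans wy)// ge_min lexx.
    have [|i gi] := Hg (leqnn _) x y true false zxr wyr.
      have := metric_triangle z x w; have := metric_triangle x y w.
      by rewrite (metric_sym y w) /dl; lra.
    by exists (t i) => /eqP; rewrite subr_eq0 => /eqP.
move=> f e cf e0.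
have [n|//|g [cg fg Gg]] := @isdense_bigcap R Z 1 (fun n f => forall p, K n p -> P f p) _ _ f e cf e0.
  exact: isopen_compact.
exists g; split=> // z w zw.
have [|n nlt] := @ltr_add_invr R 0 (mdist z w); first by rewrite mdist_gt0; exact/eqP.
rewrite add0r in nlt; have [k gk] := Gg n (z, w) (ltW nlt).
by exists k => E; apply: gk; rewrite /= E subrr.
Qed.

End generic_functions.

(** * Markers and towers *)

Section markers.
Context (R : realType) (Z : metricType R) (T T' : Z -> Z) (D M : nat).
Hypotheses (cZ : compact [set: Z]) (dimZ : dim_lt Z D).
Hypotheses (TK : cancel T T') (T'K : cancel T' T).
Hypotheses (cT : continuous T) (cT' : continuous T') (aT : aperiodic T).

Let injT : injective T := can_inj TK.

Lemma iter_inv_sub j t z : (j <= t)%N -> iter j T' (iter t T z) = iter (t - j) T z.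
Proof. by move=> jt; rewrite -{1}(subnKC jt) iterD iter_cancel. Qed.

(** A conjunction of strict signs written as positivity of one continuous function. The window
    extends both ways, so a new mark respects old ones before and after it. *)
Fixpoint window_min (h u : Z -> R) (k : nat) (z : Z) : R :=
  if k is k'.+1 then Num.min (window_min h u k' z)
    (Num.min (- u (iter k T z)) (- u (iter k T' z)))
  else Num.min (h z) (- u z).

Lemma continuous_window_min h u k : continuous h -> continuous u ->
  continuous (window_min h u k).
Proof.
move=> ch cu; have cN (g : Z -> Z) : continuous g -> continuous (fun z => - u (g z)).
  by move=> cg x; apply: cvgN; apply: (@continuous_comp _ _ _ g u); [exact: cg|exact: cu].
elim: k => [|k IH]; first by apply: continuous_minr => //; apply: (cN id) => x; exact: cvg_id.
by apply: continuous_minr => //; apply: continuous_minr; apply: cN; exact: continuous_iter.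
Qed.

Lemma window_min_gt0 h u k z : 0 < window_min h u k z <->
  0 < h z /\ forall j, (j <= k)%N -> u (iter j T z) < 0 /\ u (iter j T' z) < 0.
Proof.
elim: k => [|k IH] /=.
  rewrite lt_min oppr_gt0; split; first by move=> /andP[-> uz]; split=> // -[|].
  by move=> [-> /(_ 0%N isT)[-> _]].
rewrite !lt_min !oppr_gt0; split.
  move=> /andP[/IH[-> H] /andP[u1 u2]]; split=> // j.
  by rewrite leq_eqVlt => /orP[/eqP ->|/H].
move=> [hz H]; have [u1 u2] := H _ (leqnn _).
rewrite !iterS in u1 u2; rewrite u1 u2 !andbT; apply/IH; split=> // j jk.
by apply: H; exact: leqW.
Qed.

Lemma window_min_eq0 h u k z : window_min h u k z = 0 ->
  h z = 0 \/ exists2 j, (j <= k)%N & u (iter j T z) = 0 \/ u (iter j T' z) = 0.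
Proof.
have oppr0E (x : R) : - x = 0 -> x = 0 by move/eqP; rewrite oppr_eq0 => /eqP.
elim: k => [|k IH] /=.
  by case: leP => _; [left | move/oppr0E => uz; right; exists 0%N; [|left]].
case: leP => _; first by move=> /IH[|[j jk H]]; [left|right; exists j => //; exact: leqW].
by case: leP => _ /oppr0E H; right; exists k.+1 => //; [left|right].
Qed.

(* Greedy choice: stage [n'] marks the points of [0 < h n'] that are at distance
   more than [M] along the orbit from all marked points.  Marked means positive,
   unmarked means negative, and a zero of [marker h n] comes from a zero of some
   [h i] at a nearby time. *)
Fixpoint marker (h : nat -> Z -> R) (n : nat) (z : Z) : R :=
  if n is n'.+1 then Num.max (marker h n' z) (window_min (h n') (marker h n') M z)
  else - 1.

Definition window_disjoint (u : Z -> R) := forall z j, (0 < j <= M)%N ->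
  0 < u z -> ~ 0 < u (iter j T z).
Definition eventually_nonzero (u : Z -> R) := forall z, exists K, forall t,
  (K <= t)%N -> u (iter t T z) <> 0.

Lemma continuous_marker h n : (forall i, continuous (h i)) -> continuous (marker h n).
Proof.
move=> ch; elim: n => [|n IH]; first by move=> z; exact: cvg_cst.
by apply: continuous_maxr => //; exact: continuous_window_min.
Qed.

Lemma marker_disjoint h n : (forall i, window_disjoint (h i)) ->
  window_disjoint (marker h n).
Proof.
move=> dh; elim: n => [|n IH] z j jM /=.
  by rewrite ltNge lerN10.
rewrite !lt_max => /orP[z1|/window_min_gt0[h1 u1]] /orP[z2|/window_min_gt0[h2 u2]].
- exact: IH jM z1 z2.
- have [_] := u2 j (andP jM).2.
  by rewrite (iter_cancel _ TK) ltNge ltW.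
- have [+ _] := u1 j (andP jM).2.
  by rewrite ltNge ltW.
- exact: dh jM h1 h2.
Qed.

Lemma marker_eventually_nonzero h n : (forall i, eventually_nonzero (h i)) ->
  eventually_nonzero (marker h n).
Proof.
move=> eh; elim: n => [|n IH] z.
  by exists 0%N => t _ /= /eqP; rewrite oppr_eq0 oner_eq0.
have [K1 H1] := IH z; have [K2 H2] := eh n z.
(* The window looks back [M] steps, which must not lead below time [K1]. *)
exists (maxn (K1 + M) K2) => t; rewrite geq_max => /andP[tK1 tK2] /=.
have tK1' : (K1 <= t)%N by apply: leq_trans tK1; exact: leq_addr.
case: leP => _; last exact: H1.
move=> /window_min_eq0[|[j jM]]; first exact: H2.
case; first by rewrite -iterD; apply: H1; rewrite (leq_trans tK1')// leq_addl.
have jt : (j <= t)%N by lia.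
by rewrite iter_inv_sub//; apply: H1; lia.
Qed.

(** If [marker h n] is nowhere positive on the forward orbit, then from some time on it is negative
    and not merely nonpositive; a late visit to [0 < h n] then finds its window free and gets
    marked. *)
Lemma marker_cover h n : (forall i, eventually_nonzero (h i)) ->
  forall z, exists K, forall t i, (K <= t)%N -> (i < n)%N ->
    0 < h i (iter t T z) -> exists t', 0 < marker h n (iter t' T z).
Proof.
move=> eh; elim: n => [|n IH] z; first by exists 0%N.
have [K1 H1] := IH z; have [K2 H2] := marker_eventually_nonzero n eh z.
exists (maxn K1 (K2 + M)) => t i; rewrite geq_max => /andP[tK1 tK2].
rewrite ltnS leq_eqVlt => /orP[/eqP ->|iln] hit; last first.
  by have [t' t'P] := H1 t i tK1 iln hit; exists t'; rewrite /= lt_max t'P.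
have [[t' t'P]|nt'] := pselect (exists t', 0 < marker h n (iter t' T z)).
  by exists t'; rewrite /= lt_max t'P.
have neg s : (K2 <= s)%N -> marker h n (iter s T z) < 0.
  move=> Ks; rewrite lt_neqAle; apply/andP; split; first exact/eqP/H2.
  by rewrite leNgt; apply/negP => ?; apply: nt'; exists s.
exists t; rewrite /= lt_max; apply/orP; right; apply/window_min_gt0; split=> // j jM.
split; first by rewrite -iterD; apply: neg; lia.
by rewrite iter_inv_sub; [apply: neg|]; lia.
Qed.

(** By aperiodicity a small ball about [z0] misses its first [M] images; a bump supported in it is
    made generic. *)
Lemma exists_local_marker (z0 : Z) : exists h : Z -> R, [/\ continuous h,
  window_disjoint h, eventually_nonzero h & nbhs z0 [set z | 0 < h z]].
Proof.
have near_disj : \forall z \near z0, forall j : 'I_M,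
    mdist (iter j.+1 T z0) (iter j.+1 T z) < mdist z0 (iter j.+1 T z0) / 2.
  apply: filter_forall => j.
  have c0 : 0 < mdist z0 (iter j.+1 T z0) / 2.
    by rewrite divr_gt0// mdist_gt0; apply/eqP => /esym; exact: aT.
  have := @continuous_iter _ _ j.+1 cT z0 _ (nbhsx_ballx _ _ c0).
  by rewrite ballEmdist.
have near_dist : \forall z \near z0, forall j : 'I_M,
    mdist z0 z < mdist z0 (iter j.+1 T z0) / 2.
  apply: filter_forall => j.
  have c0 : 0 < mdist z0 (iter j.+1 T z0) / 2.
    by rewrite divr_gt0// mdist_gt0; apply/eqP => /esym; exact: aT.
  by have := nbhsx_ballx z0 _ c0; rewrite ballEmdist.
have [r r0 rP] : exists2 r, 0 < r & forall z, mdist z0 z < r -> forall j : 'I_M,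
    mdist (iter j.+1 T z0) (iter j.+1 T z) < mdist z0 (iter j.+1 T z0) / 2 /\
    mdist z0 z < mdist z0 (iter j.+1 T z0) / 2.
  have : \forall z \near z0, (forall j : 'I_M,
    mdist (iter j.+1 T z0) (iter j.+1 T z) < mdist z0 (iter j.+1 T z0) / 2) /\
    (forall j : 'I_M, mdist z0 z < mdist z0 (iter j.+1 T z0) / 2).
    exact: filterI near_disj near_dist.
  move=> /nbhs_ballP[r /= r0 rH]; exists r => // z zr j.
  by have [h1 h2] := rH z (eq_ind_r (fun B : set Z => B z) zr (ballEmdist z0 r)); split.
(* After a change of at most [r / 4] this is still positive at distance below [r / 4] from [z0] and
   negative from distance [r] on. *)
pose f (_ : 'I_1) z := r / 2 - mdist z0 z.
have cf : cfam f.
  by move=> c z; apply: cvgB; [exact: cvg_cst | exact: continuous_mdist].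
have r4 : 0 < r / 4 by rewrite divr_gt0.
have [g [cg fg gz]] := isdense_eventually_nonzero cZ dimZ TK T'K cT cT' aT cf r4.
have gpos z : 0 < g 0 z -> mdist z0 z < r.
  by move=> gz0; have := fg 0 z; rewrite ler_distl /f => /andP[_]; lra.
exists (g 0); split => //.
- move=> z j /andP[j0 jM] /gpos zr /gpos jr.
  have jM1 : (j.-1 < M)%N by rewrite prednK.
  have [+ _] := rP z zr (Ordinal jM1); have [_] := rP _ jr (Ordinal jM1).
  have -> : (Ordinal jM1).+1 = j by exact: prednK.
  have := metric_triangle z0 (iter j T z) (iter j T z0).
  by rewrite (metric_sym (iter j T z) (iter j T z0)); lra.
- apply/nbhs_ballP; exists (r / 4) => //= z; rewrite ballEmdist /= => zr.
  by have := fg 0 z; rewrite ler_distl /f => /andP[+ _]; lra.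
Qed.

(** By compactness every point meets the marker function [a] at a uniform level [c] within [K]
    steps; dividing by [c] and clamping turns this level into the value 1. *)
Lemma exists_marker : exists2 w : Z -> R,
  [/\ continuous w, forall z, 0 <= w z <= 1 &
    forall z j, (0 < j <= M)%N -> 0 < w z -> w (iter j T z) = 0] &
  exists K, forall z, exists2 i, (i <= K)%N & w (iter i T' z) = 1.
Proof.
pose Q (A : set Z) := exists n (h : nat -> Z -> R), [/\ forall i, continuous (h i),
  forall i, window_disjoint (h i), forall i, eventually_nonzero (h i) &
  forall z, A z -> exists2 i, (i < n)%N & 0 < h i z].
have [n [h [ch dh eh hT]]] : Q setT.
  apply: compact_set_ind cZ _ _ _ _.
  - exists 0%N, (fun _ _ => 1 - 2); split=> // i.
    + by move=> z; exact: cvg_cst.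
    + by move=> z j _; rewrite ltNge; have -> : (1 - 2 : R) <= 0 by lra.
    + by move=> z; exists 0%N => t _; lra.
  - by move=> A B AB [n [h [? ? ? H]]]; exists n, h; split=> // z /AB/H.
  - move=> A B [n [h [c1 d1 e1 H]]] [n' [h' [c2 d2 e2 H']]].
    exists (n + n')%N, (fun i => if (i < n)%N then h i else h' (i - n)%N).
    split; try by move=> i; case: ifP.
    move=> z [/H|/H'] [i iln hi].
      by exists i; [exact: ltn_addr | rewrite iln].
    by exists (n + i)%N; [rewrite ltn_add2l | rewrite ltnNge leq_addr addKn].
  - move=> z _; have [h [c1 d1 e1 H]] := exists_local_marker z.
    exists [set z | 0 < h z] => //; exists 1%N, (fun=> h); split=> // y hy.
    by exists 0%N.
pose a := marker h n.
have ca : continuous a by exact: continuous_marker.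
have da : window_disjoint a by exact: marker_disjoint.
have aT' z : exists t, 0 < a (iter t T z).
  have [K H] := marker_cover n eh z.
  have [i iln hi] := hT (iter K T z) I.
  exact: H (leqnn _) iln hi.
pose Q' (A : set Z) := exists c K, 0 < c /\
  forall z, A z -> exists2 t, (t <= K)%N & c <= a (iter t T z).
have [c [K [c0 cK]]] : Q' setT.
  apply: compact_set_ind cZ _ _ _ _.
  - by exists 1, 0%N.
  - by move=> A B AB [c [K [c0 H]]]; exists c, K; split=> // z /AB/H.
  - move=> A B [c [K [c0 H]]] [c' [K' [c0' H']]].
    exists (Num.min c c'), (maxn K K'); split; first by rewrite lt_min c0.
    move=> z [/H|/H'] [t tK ct]; exists t => //.
    + by rewrite leq_max tK.
    + by rewrite ge_min ct.
    + by rewrite leq_max tK orbT.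
    + by rewrite ge_min ct orbT.
  - move=> z _; have [t at0] := aT' z.
    have a20 : 0 < a (iter t T z) / 2 by rewrite divr_gt0.
    have cat : continuous (fun z => a (iter t T z)).
      move=> x; apply: (@continuous_comp _ _ _ (iter t T) a); last exact: ca.
      exact: continuous_iter.
    exists [set y | `|a (iter t T z) - a (iter t T y)| < a (iter t T z) / 2].
      by apply/cvgr_dist_lt => //; exact: cat.
    exists (a (iter t T z) / 2), t; split=> // y /=.
    by rewrite ltr_norml => /andP[? ?]; exists t => //; lra.
have wE z : (0 < clamp01 (a z / c)) = (0 < a z).
  by rewrite clamp01_gt0 pmulr_lgt0 ?invr_gt0.
exists (fun z => clamp01 (a z / c)); first split.
- by apply: continuous_clamp01 => z; apply: cvgM; [exact: ca|exact: cvg_cst].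
- by move=> z; rewrite clamp01_ge0 clamp01_le1.
- move=> z j jM; rewrite wE => az; apply/eqP/negPn/negP; rewrite clamp01_neq0.
  by rewrite pmulr_lgt0 ?invr_gt0//; apply/negP; move/(_ z j jM az): da => /negP.
(* Going back [K] steps before looking forward turns a return time into a past time of [z]. *)
exists K => z; have [t tK ct] := cK (iter K T' z) I.
exists (K - t)%N; first exact: leq_subr.
rewrite clamp01_id1// ler_pdivlMr// mul1r; move: ct.
by rewrite -{1}(subnKC tK) iterD (iter_cancel _ T'K).
Qed.

End markers.

Section tower.
Context (R : realType) (Z : metricType R) (T T' : Z -> Z) (D L : nat).
Hypotheses (cZ : compact [set: Z]) (dimZ : dim_lt Z D).
Hypotheses (TK : cancel T T') (T'K : cancel T' T).
Hypotheses (cT : continuous T) (cT' : continuous T') (aT : aperiodic T).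

(* Expected length of the backward walk that stops at [z] with probability
   [w z], truncated at [n] steps. *)
Fixpoint walk_length (w : Z -> R) (n : nat) (z : Z) : R :=
  if n is n'.+1 then (1 - w z) * (1 + walk_length w n' (T' z)) else 0.

(** The walk surely stops before step [n], so truncating it later changes nothing. *)
Lemma walk_length_stable w n z i : (i < n)%N -> w (iter i T' z) = 1 ->
  walk_length w n.+1 z = walk_length w n z.
Proof.
elim: n z i => // n IH z [_ /= wz|i iln wi]; first by rewrite wz subrr !mul0r.
by rewrite [LHS]/= -/(walk_length w n.+1 (T' z)) (IH (T' z) i)// -iterSr.
Qed.

(** The walk length satisfies [n (T z) = (1 - w (T z)) * (1 + n z)], so it grows by exactly 1 where
    [w (T z) = 0]. Marks are more than [L] apart: the run starts at a mark met at a positive time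
    below [L], or at time 0 if there is none. *)
Lemma exists_tower_function : (0 < L)%N -> exists n : Z -> R, [/\ continuous n,
  exists P : nat, forall z, 0 <= n z <= P%:R &
  forall z, exists2 e, (e < L)%N &
    forall i, (i < L)%N -> n (iter (e + i) T z) = n (iter e T z) + i%:R].
Proof.
move=> L0.
have [w [cw w01 dw] [K KP]] := @exists_marker R Z T T' D L cZ dimZ TK T'K cT cT' aT.
pose n := walk_length w K.+1.
have cn k : continuous (walk_length w k).
  elim: k => [|k IH] z; first exact: cvg_cst.
  apply: cvgM; first by apply: cvgB; [exact: cvg_cst | exact: cw].
  apply: cvgD; first exact: cvg_cst.
  by apply: (@continuous_comp _ _ _ T' (walk_length w k)); [exact: cT'|exact: IH].
have n0P k z : 0 <= walk_length w k z <= k%:R.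
  elim: k z => [|k IH] z /=; first by rewrite lexx.
  have /andP[w0 w1] := w01 z; have /andP[n0 n1] := IH (T' z).
  by rewrite -natr1; apply/andP; split; nra.
have nS z : w (T z) = 0 -> n (T z) = n z + 1.
  move=> wTz; have [i iK wi] := KP (T z).
  rewrite /n -(@walk_length_stable _ K.+1 _ i)// [LHS]/= wTz subr0 mul1r TK addrC.
  by [].
have run e z : (forall i, (0 < i < L)%N -> w (iter (e + i) T z) = 0) ->
    forall i, (i < L)%N -> n (iter (e + i) T z) = n (iter e T z) + i%:R.
  move=> H; elim=> [|i IH] iL; first by rewrite addn0 addr0.
  rewrite addnS iterS nS; last by rewrite -iterS -addnS H.
  by rewrite IH ?(ltnW iL)// -addrA natr1.
exists n; split; first exact: cn.
  by exists K.+1 => z; exact: n0P.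
move=> z; have [[e [eL we]]|ne] := pselect (exists e, (0 < e < L)%N /\ 0 < w (iter e T z)).
  exists e; first by case/andP: eL.
  apply: run => i /andP[i0 iL].
  by rewrite addnC iterD; apply: dw we; rewrite i0 ltnW.
exists 0%N => //; apply: run => i iL.
rewrite add0n; apply/eqP/negPn/negP => wi.
apply: ne; exists i; split=> //; rewrite lt0r wi.
by case/andP: (w01 (iter i T z)).
Qed.

End tower.

(** * Common refinements of covers *)

Section refinable.
Context (R : realType) (X : metricType R).
Implicit Types a b c : seq (set X).

Section common_refinement.
Variables (b c : seq (set X)).
Hypotheses (cb : open_cover b) (cc : open_cover c).

Let ps a (i : nat) (x : X) : R := \sum_(k < size a | (k < i)%N) punity k x.

Let ps_cont a i : open_cover a -> continuous (ps a i).
Proof. by move=> ca; apply: continuous_bigsum => k; exact: continuous_punity. Qed.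

Let psS a x (i : 'I_(size a)) : ps a i.+1 x = ps a i x + punity i x.
Proof.
rewrite /ps (bigD1 i) ?ltnSn//= addrC; congr (_ + _); apply: eq_bigl => k.
by rewrite ltnS ltn_neqAle andbC.
Qed.

Let ps_le a x i j : open_cover a -> (i <= j)%N -> ps a i x <= ps a j x.
Proof.
move=> ca ij; rewrite /ps [leRHS](bigID (fun k : 'I_(size a) => (k < i)%N))/=.
have -> : \sum_(k < size a | (k < j)%N && (k < i)%N) punity k x = ps a i x.
  by apply: eq_bigl => k; apply/andb_idl => /leq_trans; apply.
by rewrite lerDl sumr_ge0// => k _; exact: punity_ge0.
Qed.

Let ps_first a x : open_cover a ->
  exists i : 'I_(size a), ps a i x = 0 /\ 0 < punity i x.
Proof.
move=> ca.
have ps1 : ps a (size a) x = 1.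
  by rewrite -(sum_punity ca x); apply: eq_bigl => k; rewrite ltn_ord.
have ps0 : ps a 0 x = 0 by rewrite /ps big_pred0.
have ex : exists n, 0 < ps a n x by exists (size a); rewrite ps1.
have [[|i] iP imin] := ex_minnP ex; first by rewrite ps0 ltxx in iP.
have psi : ps a i x = 0.
  apply/eqP; rewrite eq_le -{2}ps0 ps_le// andbT leNgt; apply/negP => /imin.
  by rewrite ltnn.
have ia : (i < size a)%N.
  rewrite ltnNge; apply/negP => ai; have := ps_le x ca ai.
  by rewrite ps1 psi ler10.
exists (Ordinal ia); split => //.
by have := psS x (Ordinal ia); rewrite psi add0r => <-.
Qed.

(* The partitions of unity cut [0, 1] into two systems of consecutive
   intervals; [W i j] says that the i-th interval of the first overlaps the
   j-th of the second, and p and q consecutive intervals have at most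
   p + q - 1 overlaps. *)
Let W (i : 'I_(size b)) (j : 'I_(size c)) := [set x |
  Num.max (ps b i x) (ps c j x) < Num.min (ps b i.+1 x) (ps c j.+1 x)].

Let WP i j x : W i j x -> [/\ ps b i x < ps b i.+1 x, ps c j x < ps c j.+1 x,
  ps b i x < ps c j.+1 x & ps c j x < ps b i.+1 x].
Proof.
by rewrite /W /= lt_min !gt_max => /andP[/andP[-> ->] /andP[-> ->]].
Qed.

Let open_W i j : open (W i j).
Proof.
have -> : W i j = (fun x => Num.min (ps b i.+1 x) (ps c j.+1 x)
     - Num.max (ps b i x) (ps c j x)) @^-1` [set r : R | 0 < r].
  by apply/seteqP; split => x; rewrite /W /= subr_gt0.
apply: open_comp; last exact: open_gt.
move=> x _; apply: cvgB.
  by apply: continuous_minr; exact: ps_cont.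
by apply: continuous_maxr; exact: ps_cont.
Qed.

Let fin_mult (n m : nat) (w : 'I_n -> 'I_m -> set X) x :
  mult [seq w i j | i <- enum 'I_n, j <- enum 'I_m] x =
  #|[pred ij : 'I_n * 'I_m | `[< w ij.1 ij.2 x >]]|.
Proof.
rewrite /mult -sum1_count big_mkcond big_allpairs_dep -sum1_card [RHS]big_mkcond /=.
rewrite -(pair_bigA _ (fun i j => if `[< w i j x >] then 1%N else 0%N)) /=.
by rewrite big_enum; apply: eq_bigr => i _; rewrite big_enum.
Qed.

Lemma common_refinement k l : (forall x, (mult b x <= k.+1)%N) ->
  (forall x, (mult c x <= l.+1)%N) ->
  exists w, [/\ open_cover w,
    forall V, V \in w -> exists A B, [/\ A \in b, B \in c & V `<=` A `&` B] &
    forall x, (mult w x <= (k + l).+1)%N].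
Proof.
move=> bk cl.
exists [seq W i j | i <- enum 'I_(size b), j <- enum 'I_(size c)].
have memW i j : W i j \in [seq W i j | i <- enum 'I_(size b), j <- enum 'I_(size c)].
  by apply/allpairsP; exists (i, j); rewrite !mem_enum.
split.
- split.
    by move=> V /allpairsP[[i j] [_ _ ->]]; exact: open_W.
  apply/seteqP; split => // x _.
  have [i [i0 ip]] := ps_first x cb; have [j [j0 jp]] := ps_first x cc.
  exists (W i j); first exact: memW.
  by rewrite /W /= !psS i0 j0 !add0r maxxx lt_min ip jp.
- move=> V /allpairsP[[i j] [_ _ ->]] /=.
  exists (nth set0 b i), (nth set0 c j); rewrite !mem_nth//; split=> // x /WP[].
  by rewrite !psS !ltrDl => ? ? _ _; split; apply/punity_gt0; eassumption.
- move=> x; rewrite fin_mult.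
  pose P := [pred ij : 'I_(size b) * 'I_(size c) | `[< W ij.1 ij.2 x >]].
  (* Overlaps are split by which interval starts last. If it is the one of [b], ties included, its
     index determines the overlap; otherwise the index of [c] does, and it differs from [j0], whose
     interval starts at 0. This saves the 1. *)
  pose Q := [pred ij : 'I_(size b) * 'I_(size c) | ps c ij.2 x <= ps b ij.1 x].
  rewrite -(cardID Q P).
  have [j0 [tj0 cj0]] := ps_first x cc.
  have c1 : (#|[predI P & Q]| <= k.+1)%N.
    rewrite (leq_trans _ (bk x))// -(card_punity cb).
    have inj : {in [predI P & Q] &, injective (fun ij : 'I_(size b) * 'I_(size c) => ij.1)}.
      move=> [i j] [i' j']; rewrite !inE /= => /andP[/asboolP/WP[_ _ ij _] ji].
      move=> /andP[/asboolP/WP[_ _ ij' _] ji'] ii'; rewrite -ii' in ij' ji' *.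
      congr (_, _); apply/eqP/negPn/negP; rewrite neq_lt => /orP[jj|jj].
        by have := ps_le x cc jj; lra.
      by have := ps_le x cc jj; lra.
    rewrite -(card_in_image inj); apply/subset_leq_card/fintype.subsetP.
    move=> i /fintype.imageP[[i' j'] + ->] /=; rewrite !inE /= => /andP[/asboolP/WP[+ _ _ _] _].
    by rewrite psS ltrDl => /lt0r_neq0.
  have c2 : (#|[predD P & Q]| <= l)%N.
    rewrite -ltnS (leq_trans _ (cl x))// -(card_punity cc).
    rewrite (cardD1 j0) inE lt0r_neq0// add1n ltnS.
    have inj : {in [predD P & Q] &, injective (fun ij : 'I_(size b) * 'I_(size c) => ij.2)}.
      move=> [i j] [i' j']; rewrite !inE /= -!ltNge => /andP[ji /asboolP/WP[_ _ _ ij]].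
      move=> /andP[ji' /asboolP/WP[_ _ _ ij']] ii'; rewrite -ii' in ij' ji' *.
      congr (_, _); apply/eqP/negPn/negP; rewrite neq_lt => /orP[jj|jj].
        by have := ps_le x cb jj; lra.
      by have := ps_le x cb jj; lra.
    rewrite -(card_in_image inj); apply/subset_leq_card/fintype.subsetP.
    move=> j /fintype.imageP[[i' j'] + ->] /=; rewrite !inE /= -ltNge.
    move=> /andP[ij /asboolP/WP[_ + _ _]].
    rewrite psS ltrDl => /lt0r_neq0 ->; rewrite andbT.
    apply: contraTneq ij => ->; rewrite -leNgt tj0 /ps sumr_ge0// => i _.
    exact: punity_ge0.
  by apply: leq_trans (leq_add c1 c2) _; rewrite addSn.
Qed.

End common_refinement.

(** Multiplicity being order plus one, this is D(a \/ b) <= D(a) + D(b). *)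
Lemma refinable_join a b k l : refinable a k.+1 -> refinable b l.+1 ->
  refinable (cover_join a b) (k + l).+1.
Proof.
move=> [a' [ca' ra ka]] [b' [cb' rb lb]].
have [w [cw rw mw]] := common_refinement ca' cb' ka lb.
exists w; split=> // V /rw[A [B [/ra[A' aA' AA'] /rb[B' bB' BB'] VAB]]].
exists (A' `&` B'); first by apply/allpairsP; exists (A', B').
by move=> x /VAB[/AA' ? /BB' ?].
Qed.

Lemma refinable_refines a b k : refines b a -> refinable b k -> refinable a k.
Proof.
move=> ba [c [cc rc kc]]; exists c; split=> // V /rc[U Ub VU].
by have [U' U'a UU'] := ba U Ub; exists U' => //; exact: subset_trans UU'.
Qed.

Lemma refinable_size a : open_cover a -> refinable a (size a).
Proof.
move=> ca; exists a; split=> // [V Va|x]; first by exists V.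
exact: count_size.
Qed.

Definition preimages (f : X -> X) a := [seq f @^-1` U | U <- a].

Lemma mult_preimages f a x : mult (preimages f a) x = mult a (f x).
Proof. by rewrite /mult count_map; apply: eq_count. Qed.

Lemma open_cover_preimages f a : continuous f -> open_cover a ->
  open_cover (preimages f a).
Proof.
move=> cf [oa aT]; split.
  by move=> V /mapP[U /oa oU ->]; apply: open_comp => // x _; exact: cf.
apply/seteqP; split => // x _.
have : [set: X] (f x) by []; rewrite -aT => -[U /= Ua Ux].
by exists (f @^-1` U) => //=; exact: map_f.
Qed.

Lemma refinable_preimages f a k : continuous f -> refinable a k ->
  refinable (preimages f a) k.
Proof.
move=> cf [b [cb rb kb]]; exists (preimages f b); split.
- exact: open_cover_preimages.
- move=> V /mapP[U /rb[U' U'a UU'] ->]; exists (f @^-1` U'); first exact: map_f.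
  by move=> x /UU'.
- by move=> x; rewrite mult_preimages.
Qed.

Lemma open_cover_join a b : open_cover a -> open_cover b ->
  open_cover (cover_join a b).
Proof.
move=> [oa aT] [ob bT]; split.
  by move=> V /allpairsP[[A B] [/= /oa ? /ob ? ->]]; exact: openI.
apply/seteqP; split => // x _.
have : [set: X] x by []; rewrite -{1}aT => -[A /= Aa Ax].
have : [set: X] x by []; rewrite -{1}bT => -[B /= Bb Bx].
by exists (A `&` B) => //=; apply/allpairsP; exists (A, B).
Qed.

Lemma mem_big_cover_join (F : nat -> seq (set X)) n V :
  V \in \big[@cover_join X/[:: setT]]_(k < n) F k <->
  exists2 u : nat -> set X, (forall k, (k < n)%N -> u k \in F k) &
    V = [set x | forall k, (k < n)%N -> u k x].
Proof.
elim: n F V => [|n IH] F V.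
  rewrite big_ord0 inE; split => [/eqP ->|[u _ ->]].
    by exists (fun=> setT) => //; apply/seteqP; split.
  by apply/eqP/seteqP; split.
rewrite big_ord_recl; split.
  move=> /allpairsP[[A B] [/= AF + ->]].
  move=> /(IH (fun k => F k.+1))[u uF ->].
  exists (fun k => if k is k'.+1 then u k' else A); first by case.
  apply/seteqP; split=> x /=.
    by move=> [Ax ux] [|k] //; exact: ux.
  by move=> H; split; [exact: (H 0%N)|move=> k kn; exact: (H k.+1)].
move=> [u uF ->]; apply/allpairsP.
exists (u 0%N, [set x | forall k, (k < n)%N -> u k.+1 x]); split => /=.
- exact: uF.
- by apply/(IH (fun k => F k.+1)); exists (fun k => u k.+1) => // k kn; exact: uF.
- apply/seteqP; split=> x /=.
    by move=> H; split; [exact: H|move=> k kn; exact: H].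
  by move=> [u0 uS] [|k] //; exact: uS.
Qed.

Lemma mem_cover_iter (T : X -> X) a n V : V \in cover_iter T a n <->
  exists2 u : nat -> set X, (forall k, (k < n)%N -> u k \in a) &
    V = [set x | forall k, (k < n)%N -> u k (iter k T x)].
Proof.
rewrite /cover_iter; split.
  move=> /(mem_big_cover_join (fun k => [seq iter k T @^-1` U | U <- a]))[u uF ->].
  have /choice[v vP] k : exists U, (k < n)%N -> U \in a /\ u k = iter k T @^-1` U.
    have [kn|] := ltnP k n; last by exists set0.
    by have /mapP[U Ua ->] := uF k kn; exists U.
  exists v => [k /vP[]//|]; apply/seteqP; split => x H k kn.
    by have := H k kn; have [_ ->] := vP k kn.
  by have [_ ->] := vP k kn; exact: H.
move=> [u ua ->].
apply/(mem_big_cover_join (fun k => [seq iter k T @^-1` U | U <- a])).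
by exists (fun k => iter k T @^-1` u k) => // k /ua; exact: map_f.
Qed.

Lemma open_cover_iter (T : X -> X) a n : continuous T -> open_cover a ->
  open_cover (cover_iter T a n).
Proof.
move=> cT ca; apply: big_ind.
- split; first by move=> V; rewrite inE => /eqP ->; exact: openT.
  by apply/seteqP; split => // x _; exists setT => //=; rewrite inE.
- by move=> b c; exact: open_cover_join.
- by move=> k _; apply: open_cover_preimages => //; exact: continuous_iter.
Qed.

Lemma refines_cover_iterD (T : X -> X) a n m :
  refines (cover_join (cover_iter T a n) (preimages (iter n T) (cover_iter T a m)))
    (cover_iter T a (n + m)).
Proof.
move=> _ /allpairsP[[A B] [/= /mem_cover_iter[u ua ->] + ->]].
move=> /mapP[_ /mem_cover_iter[v va ->] ->].
exists [set x | forall k, (k < n + m)%N ->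
    (if (k < n)%N then u k else v (k - n)%N) (iter k T x)].
  apply/mem_cover_iter; exists (fun k => if (k < n)%N then u k else v (k - n)%N) => //.
  by move=> k; case: (ltnP k n) => [kn _|nk knm]; [exact: ua | apply: va; lia].
move=> x [/= ux vx] k; case: (ltnP k n) => [kn _|nk knm]; first exact: ux.
have := vx (k - n)%N; rewrite -iterD subnK//; apply; lia.
Qed.

End refinable.

(** * Mean dimension *)

Section fekete.
Context (R : realType).

Lemma subadditive_mul (u : nat -> nat) q m r :
  (forall n m, (u (n + m) <= u n + u m)%N) -> (u (q * m + r) <= q * u m + u r)%N.
Proof.
move=> su; elim: q => [|q IH] //; rewrite mulSn -addnA (leq_trans (su _ _))//.
by rewrite mulSn -addnA leq_add2l.
Qed.

(** Fekete's lemma, with the infimum as limit: divide [n] by a nearly optimal [m.+1]; the remainder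
    contributes at most a constant [C], negligible against [n]. *)
Lemma cvgn_subadditive (u : nat -> nat) :
  (forall n m, (u (n + m) <= u n + u m)%N) ->
  cvgn (fun n => (u n)%:R / n%:R : R).
Proof.
move=> su.
pose S := [set ((u n.+1)%:R / n.+1%:R : R) | n in [set: nat]].
have S0 : has_inf S.
  split; first by exists ((u 1%N)%:R / 1%:R), 0%N.
  by exists 0 => _ [n _ <-]; rewrite divr_ge0.
apply/cvg_ex; exists (inf S); apply/cvgrPdist_le => e e0.
have e20 : 0 < e / 2 by rewrite divr_gt0.
have [_ [m _ <-] mS] := inf_adherent e20 S0.
pose C := (\sum_(r < m.+1) u r)%N.
have uC r : (r < m.+1)%N -> (u r <= C)%N.
  by move=> rm; rewrite /C (bigD1 (Ordinal rm))//= leq_addr.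
have [K CK] : exists K : nat, C%:R / (e / 2) <= K%:R.
  have := archi_boundP (divr_ge0 (ler0n R C) (ltW e20)).
  by move/ltW; exists (Num.bound (C%:R / (e / 2))).
near=> n.
have n0 : (0 < n)%N by near: n; exists 1%N.
have nK : (K <= n)%N by near: n; exists K.
have lo : inf S <= (u n)%:R / n%:R.
  by apply: ge_inf; [exact: S0.2 | exists n.-1 => //; rewrite prednK].
have nR0 : 0 < n%:R :> R by rewrite ltr0n.
have mR0 : 0 < m.+1%:R :> R by rewrite ltr0n.
have hi : (u n)%:R / n%:R <= (u m.+1)%:R / m.+1%:R + e / 2 :> R.
  have h1 : (u n <= n %/ m.+1 * u m.+1 + C)%N.
    rewrite {1}(divn_eq n m.+1) (leq_trans (subadditive_mul _ _ _ su))//.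
    by rewrite leq_add2l uC// ltn_pmod.
  rewrite ler_pdivrMr// mulrDl.
  have h2 : (u n)%:R <= (n %/ m.+1)%:R * (u m.+1)%:R + C%:R :> R.
    by rewrite -natrM -natrD ler_nat.
  apply: le_trans h2 _; apply: lerD.
    rewrite mulrC -mulrA ler_wpM2l// mulrC ler_pdivlMr// -natrM ler_nat.
    exact: leq_divM.
  rewrite mulrC -ler_pdivrMr// (le_trans CK)// ler_nat//.
move: mS lo hi; rewrite ler_norml; set v := _ / _; set w := _ / _ => h1 h2 h3.
by apply/andP; split; lra.
Unshelve. all: by end_near. Qed.

End fekete.

Section mean_dimension.
Context (R : realType) (X : metricType R).
Hypothesis X0 : [set: X] !=set0.
Implicit Types a b : seq (set X).

Lemma sum_indic a (y : X) : \sum_(U <- a) \1_U y = (mult a y)%:R :> R.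
Proof.
rewrite /mult; elim: a => [|U a IH]; first by rewrite big_nil.
by rewrite big_cons IH /= natrD indicE.
Qed.

Lemma ordE a :
  ord R a = (ereal_sup [set (mult a y)%:R%:E | y in [set: X]] - 1)%E.
Proof. by rewrite /ord; under eq_imagel do rewrite sum_indic. Qed.

Lemma ord_le a k : (forall x, (mult a x <= k)%N) -> (ord R a <= (k%:R - 1)%:E)%E.
Proof.
move=> ak; rewrite ordE EFinB; apply: leeB => //.
by apply: ge_ereal_sup => _ [y _ <-]; rewrite lee_fin ler_nat.
Qed.

Lemma ord_ge a k x : (k <= mult a x)%N -> ((k%:R - 1)%:E <= ord R a)%E.
Proof.
move=> ak; rewrite ordE EFinB; apply: leeB => //.
apply: (@le_trans _ _ (mult a x)%:R%:E); first by rewrite lee_fin ler_nat.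
by apply: ereal_sup_ubound; exists x.
Qed.

Lemma mult_gt0 a x : open_cover a -> (0 < mult a x)%N.
Proof.
move=> [_ aT]; have : [set: X] x by []; rewrite -aT => -[V /= Va Vx].
by rewrite /mult -has_count; apply/hasP; exists V => //; exact/asboolP.
Qed.

(** The bridge from extended reals to [refinable]. On a nonempty space multiplicities of covers are
    positive, so [n] is the least one minus 1. *)
Lemma cover_dim_natE a : open_cover a -> exists n,
  [/\ cover_dim R a = n%:R%:E, refinable a n.+1 &
    forall k, refinable a k.+1 -> (n <= k)%N].
Proof.
move=> ca.
have ex : exists k, `[< refinable a k >].
  by exists (size a); apply/asboolP; exact: refinable_size.
have [n /asboolP nP nmin] := ex_minnP ex.
case: n nP nmin => [|n] nP nmin.
  exfalso; have [x _] := X0; have [b [cb _ /(_ x)]] := nP.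
  by rewrite leqNgt mult_gt0.
exists n; split => //; last first.
  by move=> k /asboolP/nmin.
have -> : n%:R = n.+1%:R - 1 :> R by rewrite -natr1 addrK.
apply/eqP; rewrite eq_le; apply/andP; split.
  have [b [cb rb kb]] := nP.
  apply: (@le_trans _ _ (ord R b)); last exact: ord_le.
  by apply: ereal_inf_lbound; exists b.
apply: le_ereal_inf_tmp => _ [b [cb rb] <-].
have [x bx] : exists x, (n.+1 <= mult b x)%N.
  apply: contrapT => nx.
  have : (n.+1 <= n)%N.
    apply: nmin; apply/asboolP; exists b; split=> // x.
    by rewrite leqNgt; apply/negP => ?; apply: nx; exists x.
  by rewrite ltnn.
exact: ord_ge bx.
Qed.

Lemma mdim_refinement (T : X -> X) (d : nat) : continuous T ->
  (mdim R T < (d%:R / 16)%:E)%E -> forall a, open_cover a ->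
  exists m b, [/\ (0 < m)%N, open_cover b, refines b (cover_iter T a (8 * m)) &
    forall x, ((mult b x).*2 <= d * m)%N].
Proof.
move=> cT md a ca.
have /choice[u uP] n := cover_dim_natE (open_cover_iter n cT ca).
have su n m : (u (n + m) <= u n + u m)%N.
  have [_ rn _] := uP n; have [_ rm _] := uP m; have [_ _] := uP (n + m)%N; apply.
  apply: (refinable_refines (@refines_cover_iterD R X T a n m)).
  apply: refinable_join => //; apply: refinable_preimages => //.
  exact: continuous_iter.
have := @cvgn_subadditive R u su.
set v := (fun n => _) => cv; pose l := limn v.
have vl : v @ \oo --> l by exact: cv.
have limE : limn (fun n : nat => (cover_dim R (cover_iter T a n) * (n%:R^-1)%:E)%E)
    = l%:E.
  have -> : (fun n : nat => (cover_dim R (cover_iter T a n) * (n%:R^-1)%:E)%E)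
      = EFin \o v.
    by apply/funext => n; have [-> _ _] := uP n; rewrite -EFinM.
  by apply/cvg_lim => //; apply: cvg_EFin; first exact: nearW; exact: vl.
have ld : l < d%:R / 16.
  rewrite -lte_fin -limE; apply: le_lt_trans md.
  by apply: ereal_sup_ubound; exists a.
(* The slack [d - 16 * c], multiplied by [m], must pay for passing from order to multiplicity, which
   costs 2 after doubling. *)
pose c := (l + d%:R / 16) / 2.
have lc : l < c by rewrite /c; lra.
have cd : 0 < d%:R - 16 * c by rewrite /c; lra.
have [N _ Nv] : \forall n \near \oo, v n < c by apply: cvgr_lt vl _ lc.
pose m := (N + Num.bound (2 / (d%:R - 16 * c))).+1.
have mbig : 2 / (d%:R - 16 * c) <= m%:R.
  have := archi_boundP (divr_ge0 (ler0n R 2) (ltW cd)).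
  move=> /ltW /le_trans; apply; by rewrite ler_nat ltnW// ltnS leq_addl.
have vm : v (8 * m)%N < c by apply: Nv; rewrite /= (leq_trans _ (leq_pmull m (isT : (0 < 8)%N)))//
  ltnW// ltnS leq_addr.
have [_ [b [cb rb bk]] _] := uP (8 * m)%N.
exists m, b; split => // x.
rewrite -(ler_nat R) natrM -muln2 natrM.
have : (mult b x)%:R <= (u (8 * m)%N)%:R + 1 :> R by rewrite natr1 ler_nat.
have m0 : 0 < m%:R :> R by rewrite ltr0n.
move: vm mbig; rewrite /v ltr_pdivrMr ?ltr0n ?muln_gt0// natrM.
rewrite ler_pdivrMr//.
have key (U B M DD e : R) : 0 < M -> 0 < DD - 16 * e -> 2 <= M * (DD - 16 * e) ->
    U < e * (8 * M) -> B <= U + 1 -> B * 2 <= DD * M by nra.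
by move=> vm mbig; exact: key m0 cd mbig vm.
Qed.

End mean_dimension.

(** * Embedding into the shift *)

Definition zit (X : Type) (T T' : X -> X) (i : int) : X -> X :=
  match i with Posz n => iter n T | Negz n => iter n.+1 T' end.

Lemma zitS (X : Type) (T T' : X -> X) i x : cancel T T' -> cancel T' T ->
  zit T T' (i + 1) x = zit T T' i (T x).
Proof.
move=> TK T'K; case: i => [n|[|n]].
- by rewrite -PoszD addn1 /zit iterSr.
- by rewrite /= TK.
- have -> : Negz n.+1 + 1 = Negz n by rewrite !NegzE; lia.
  by rewrite /zit [iter n.+2 _ _]iterSr TK.
Qed.

Section squash.
Context (R : realType).

(** The map x / (1 + |x|) onto (-1, 1), rescaled into [0, 1]: the functions built so far take
    arbitrary real values. *)
Definition squash (x : R) : R := (1 + x / (1 + `|x|)) / 2.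

Let den_gt0 (x : R) : 0 < 1 + `|x|. Proof. by rewrite ltr_pwDl. Qed.

Lemma squash_itv x : squash x \in `[0, 1].
Proof.
have := ler_norm x; have := lerNnormlW (lexx `|x|) => h1 h2.
have q1 : x / (1 + `|x|) <= 1 by rewrite ler_pdivrMr// mul1r; lra.
have q2 : -1 <= x / (1 + `|x|) by rewrite ler_pdivlMr// mulN1r; lra.
by rewrite in_itv /= /squash; apply/andP; split; lra.
Qed.

Lemma squash_inj : injective squash.
Proof.
move=> x y; rewrite /squash => E.
have {E} : x / (1 + `|x|) = y / (1 + `|y|) by lra.
move/eqP; rewrite eqr_div ?lt0r_neq0// => /eqP.
have [x0|x0] := lerP 0 x; have [y0|y0] := lerP 0 y;
  rewrite ?(ger0_norm x0) ?(ger0_norm y0) ?(ltr0_norm x0) ?(ltr0_norm y0).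
- lra.
- by have := mulr_ge0_le0 x0 (ltW y0); lra.
- by have := mulr_le0_ge0 (ltW x0) y0; lra.
- lra.
Qed.

Lemma continuous_squash : continuous squash.
Proof.
move=> x; apply: cvgM; last exact: cvg_cst.
apply: cvgD; first exact: cvg_cst.
apply: cvgM; first exact: cvg_id.
apply: cvgV; first by rewrite gt_eqF.
by apply: cvgD; [exact: cvg_cst | apply: cvg_norm; exact: cvg_id].
Qed.
End squash.

Lemma continuous_ptws (Y : topologicalType) (I : eqType) (K : topologicalType)
    (f : Y -> {ptws I -> K}) :
  (forall i, continuous (fun y => f y i)) -> continuous f.
Proof.
move=> cf y; apply/cvg_sup => i.
exact: (@continuous_comp_initial (I -> K) Y K (fun g => g i) f (cf i) y).
Qed.

Lemma continuous_eval (I : eqType) (K : topologicalType) (i : I) :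
  continuous (fun p : {ptws I -> K} => p i).
Proof. exact: (@proj_continuous I (fun=> K) i). Qed.

Section embedding.
Context (R : realType) (X : metricType R) (T T' : X -> X) (k : nat).
Hypotheses (cX : compact [set: X]) (TK : cancel T T') (T'K : cancel T' T).
Hypotheses (cT : continuous T) (cT' : continuous T').

Lemma continuous_zit i : continuous (zit T T' i).
Proof. by case: i => n; exact: continuous_iter. Qed.

Lemma embeds_of_separating (F : 'I_k -> X -> R) : cfam F ->
  (forall x y, (forall n c, F c (iter n T x) = F c (iter n T y)) -> x = y) ->
  embeds T (@full_shift R k).
Proof.
move=> cF sF.
pose sq (r : R) : set_type (`[0%R, 1%R] : set R) :=
  exist _ (squash r) (mem_set (squash_itv r)).
have csq : continuous sq.
  pose A : set R := `[0%R, 1%R]%classic.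
  apply: (@continuous_comp_initial (set_type A) R R (@set_val R A) sq).
  exact: continuous_squash.
pose phi (x : X) : shift_space R k := fun i c => sq (F c (zit T T' i x)).
have phi_inj x y : phi x = phi y -> x = y.
  move=> E; apply: sF => n c.
  have := congr1 (fun p : shift_space R k => set_val (p (Posz n) c)) E.
  by move/squash_inj.
have cphi : continuous phi.
  apply: continuous_ptws => i; apply: continuous_ptws => c x.
  apply: (@continuous_comp _ _ _ (fun x => F c (zit T T' i x)) sq); last exact: csq.
  apply: (@continuous_comp _ _ _ (zit T T' i) (F c)); last exact: cF.
  exact: continuous_zit.
have phiT : phi \o T = @full_shift R k \o phi.
  apply/funext => x; apply/funext => i; apply/funext => c.
  by rewrite /full_shift /phi /= zitS.
exists phi => //.
pose h (x : X) : range phi := exist _ (phi x) (mem_set (imageT phi x)).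
have hE x : set_val (h x) = phi x by [].
exists h => //.
have /choice[g gP] (y : range phi) : exists x, phi x = set_val y.
  by have [x _ E] := set_valP y; exists x.
have gh : cancel h g by move=> x; apply: phi_inj; exact: gP.
have hg : cancel g h by move=> y; apply: val_inj; exact: gP.
exists g; split => //.
  exact: (@continuous_comp_initial (range phi) X _ (@set_val _ (range phi)) h).
pose ev i c (y : range phi) : R := set_val ((set_val y : shift_space R k) i c).
have cev i c : continuous (ev i c).
  move=> y.
  pose K := `[0%R, 1%R]%classic : set R.
  apply: (@continuous_comp _ _ _ (fun y : range phi => (set_val y : shift_space R k) i c)
    (@set_val R K)); last exact: (@initial_continuous K R set_val).
  apply: (@continuous_comp _ _ _ (fun y : range phi => (set_val y : shift_space R k) i)
    (fun p : cube R k => p c)); last exact: continuous_eval.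
  apply: (@continuous_comp _ _ _ (@set_val _ (range phi))
    (fun p : shift_space R k => p i)); last exact: continuous_eval.
  exact: (@initial_continuous (range phi) (shift_space R k) set_val).
have evh i c x : ev i c (h x) = squash (F c (zit T T' i x)) by [].
have cevh i c : continuous (fun x => ev i c (h x)).
  move=> x; apply: (@continuous_comp _ _ _ (fun x => F c (zit T T' i x)) (@squash R)).
    apply: (@continuous_comp _ _ _ (zit T T' i) (F c)); last exact: cF.
    exact: continuous_zit.
  exact: continuous_squash.
move=> y U /=; rewrite nbhsE => -[V [oV Vgy] VU].
(* A neighbourhood of [y] missing the image under [h] of the complement of [V] is carried by [g]
   into [V]; that complement is compact, so local avoidance is enough. *)
pose Q (A : set X) := nbhs y [set y' | forall x, A x -> h x <> y'].
suff : Q (~` V).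
  rewrite /Q; apply: filterS => y' /= Hy'; apply: VU; apply: contrapT => nV.
  exact: (Hy' _ nV (hg y')).
have cV : compact (~` V).
  by apply: (subclosed_compact _ cX) => //; exact: open_closedC.
apply: compact_set_ind cV _ _ _ _.
- by rewrite /Q; apply: filterS (@filterT _ (nbhs y) _) => y' _ x [].
- by move=> A B AB; rewrite /Q; apply: filterS => y' /= H x /AB; exact: H.
- move=> A B; rewrite /Q => QA QB; apply: filterS (filterI QA QB).
  by move=> y' [/= HA HB] x [/HA|/HB].
- move=> x nVx.
  have [i [c ne]] : exists i c, ev i c (h x) <> ev i c y.
    apply: contrapT => H; apply: nVx; suff <- : g y = x by [].
    apply: phi_inj; apply: etrans (gP y) _; apply/funext => i; apply/funext => c.
    by apply: val_inj; apply: contrapT => E; apply: H; exists i, c => /esym.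
  have e0 : 0 < `|ev i c (h x) - ev i c y| / 2.
    by rewrite divr_gt0// normr_gt0 subr_eq0; exact/eqP.
  exists [set x' | `|ev i c (h x) - ev i c (h x')| < `|ev i c (h x) - ev i c y| / 2].
    by apply/cvgr_dist_lt => //; exact: (cevh i c x).
  have : nbhs y [set y' | `|ev i c y - ev i c y'| < `|ev i c (h x) - ev i c y| / 2].
    exact: (cev i c y _ (nbhsx_ballx (ev i c y) _ e0)).
  rewrite /Q; apply: filterS => y' /= yy' x' xx' E; rewrite E in xx'.
  have := ler_distD (ev i c y') (ev i c (h x)) (ev i c y).
  by rewrite (distrC (ev i c y')); lra.
Qed.
End embedding.

(** * Separating points in a fibre *)

Section fibers.
Context (R : realType) (X Z : metricType R) (T T' : X -> X) (S S' : Z -> Z).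
Context (p : X -> Z) (D d : nat).
Hypotheses (cX : compact [set: X]) (cZ : compact [set: Z]) (dimZ : dim_lt Z D).
Hypotheses (TK : cancel T T') (T'K : cancel T' T).
Hypotheses (cT : continuous T) (cT' : continuous T').
Hypotheses (SK : cancel S S') (S'K : cancel S' S).
Hypotheses (cS : continuous S) (cS' : continuous S') (aS : aperiodic S).
Hypotheses (cp : continuous p) (pT : p \o T = S \o p).
Hypothesis mdT : forall a, open_cover a ->
  exists m b, [/\ (0 < m)%N, open_cover b, refines b (cover_iter T a (8 * m)) &
    forall x, ((mult b x).*2 <= d * m)%N].

(** Equal to 1 up to distance 1/2 and to 0 from distance 1 on, so translates by distinct even
    integers have disjoint supports. *)
Definition tent (r : R) : R := clamp01 (2 - 2 * `|r|).

Lemma distn_ge1 (i j : nat) : i != j -> 1 <= `|i%:R - j%:R : R|.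
Proof.
rewrite neq_ltn distrC => /orP[] ij; [|rewrite distrC];
  by rewrite ger0_norm ?subr_ge0 ?ler_nat ?(ltnW ij)// -natrB ?(ltnW ij)//
    ler1n subn_gt0.
Qed.

Lemma tent_neq0 r : tent r != 0 -> `|r| < 1.
Proof. by rewrite clamp01_neq0; lra. Qed.

Lemma tent_eq1 r : `|r| <= 1 / 2 -> tent r = 1.
Proof. by move=> h; apply: clamp01_id1; lra. Qed.

(** Round [x] to the nearest integer, then wait for the next multiple of [N]. *)
Lemma near_multiple (N : nat) (x : R) : (0 < N)%N -> 0 <= x ->
  exists r k : nat, (r < N)%N /\ `|x + r%:R - (k * N)%:R| <= 1 / 2.
Proof.
move=> N0 x0; pose A := Num.truncn (x + 1 / 2).
have xA : `|x - A%:R| <= 1 / 2.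
  have x20 : 0 <= x + 1 / 2 by lra.
  have /andP[h1 h2] := truncn_itv x20.
  have AS : A.+1%:R = A%:R + 1 :> R by rewrite -natr1.
  move: h1 h2; rewrite -/A AS ler_norml => ? ?; apply/andP; split; lra.
pose q := (A %/ N)%N; pose s := (A %% N)%N.
have AE : A = (q * N + s)%N := divn_eq A N.
have sN : (s < N)%N by rewrite ltn_mod.
have [s0|s0] := posnP s.
  by exists 0%N, q; split=> //; move: xA; rewrite AE s0 addn0 addr0.
exists (N - s)%N, q.+1; split; first by rewrite ltn_subrL s0.
have -> : x + (N - s)%:R - (q.+1 * N)%:R = x - A%:R :> R.
  by rewrite natrB ?(ltnW sN)// AE mulSn !natrD; lra.
exact: xA.
Qed.

Lemma iter_factor n x : p (iter n T x) = iter n S (p x).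
Proof.
elim: n => // n IH; rewrite !iterS -IH.
by have := congr1 (fun f => f (iter n T x)) pT.
Qed.

(* Blocks have [N = 2 m] times, and coordinate [l] of the nerve map is read where
   [n] is within 1/2 of [2 l] modulo [N]; this gives [m * d] coordinates whatever
   the fractional part of [n].  A complete block starts at some time [s <= 3 N]
   after time 0, so the cover must control [4 N = 8 m] times, and the condition
   2 * (8 m) * (d / 16) = m * d accounts for the constant 16. *)
Lemma isdense_fiber (dl : R) : 0 < dl ->
  isdense (fun f : 'I_d -> X -> R => forall x y, p x = p y -> dl <= mdist x y ->
    exists n c, f c (iter n T x) <> f c (iter n T y)).
Proof.
move=> dl0 f e cf e0.
have e20 : 0 < e / 2 by rewrite divr_gt0.
have [a ca aP] := small_cover cX cf e20 dl0.
have [m [b [m0 cb ba bm]]] := mdT ca.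
pose N := (2 * m)%N; pose H := (6 * m)%N.
have [n [cn [P nP] tow]] : exists n : Z -> R, [/\ continuous n,
    exists P : nat, forall z, 0 <= n z <= P%:R &
    forall z, exists2 s, (s < 4 * m)%N &
      forall i, (i < 4 * m)%N -> n (iter (s + i) S z) = n (iter s S z) + i%:R].
  by apply: (@exists_tower_function R Z S S' D) => //; rewrite muln_gt0.
(* The offset [H] bounds every block start [s] below, and [2 * l + H] stays under the [8 * m] times
   controlled by the cover. *)
pose phi (lc : 'I_m * 'I_d) x := f lc.2 (iter (2 * lc.1 + H) T x).
have bP V x y k : V \in b -> V x -> V y -> (k < 8 * m)%N ->
    mdist (iter k T x) (iter k T y) < dl /\
    forall c, `|f c (iter k T x) - f c (iter k T y)| <= e / 2.
  move=> /ba[_ /mem_cover_iter[u ua ->] VU] /VU ux /VU uy k8.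
  exact: aP (ua k k8) (ux k k8) (uy k k8).
have osc V x y lc : V \in b -> V x -> V y -> `|phi lc x - phi lc y| <= e / 2.
  move=> Vb Vx Vy; have lm := ltn_ord lc.1.
  by have [|_] := bP V x y (2 * lc.1 + H)%N Vb Vx Vy; [rewrite /H; lia|apply].
have [F [cF Fphi Finj _]] := cover_map cb e20 osc.
(* Bump [i] sits at [n = 2 * i] and reads coordinate [i] modulo [m], so labels repeat with period
   [N] in [n]. *)
pose lab (i : nat) : 'I_m := Ordinal (ltn_pmod i m0).
pose th (i : 'I_P.+1) x := tent (n (p x) - (2 * i)%:R).
pose G (i : 'I_P.+1) c x := F (lab i, c) (iter (2 * lab i + H) T' x).
have [||||||g [cg fg gG]] := @perturb R X d 'I_P.+1 f th G e cf.
- move=> i; apply: continuous_clamp01 => x; apply: cvgB; first exact: cvg_cst.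
  apply: cvgM; first exact: cvg_cst.
  apply: cvg_norm; apply: cvgB; last exact: cvg_cst.
  by apply: (@continuous_comp _ _ _ p n); [exact: cp | exact: cn].
- move=> i c x; apply: (@continuous_comp _ _ _ (iter (2 * lab i + H) T') (F (lab i, c))).
    exact: continuous_iter.
  exact: cF.
- by move=> i x; exact: clamp01_ge0.
- move=> x; apply: sum_le1 => [i|i j]; first exact: clamp01_le1.
  move=> /tent_neq0 ti /tent_neq0 tj; apply: val_inj; apply/eqP.
  have [//|ij] := eqVneq (val i) (val j); exfalso.
  have : 2 <= `|(2 * i)%:R - (2 * j)%:R : R|.
    rewrite !natrM -mulrBr normrM ger0_norm// ler_peMr// distn_ge1//.
  have := ler_distD (n (p x)) (2 * i)%:R (2 * j)%:R.
  by rewrite (distrC (2 * i)%:R (n (p x))); lra.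
- exact: ltW.
- move=> i c x _.
  have -> : f c x = phi (lab i, c) (iter (2 * lab i + H) T' x).
    by rewrite /phi (iter_cancel _ T'K).
  by rewrite [leRHS](splitr e) Fphi.
exists g; split => // x y pxy xy; apply: contrapT => ng.
have gxy k c : g c (iter k T x) = g c (iter k T y).
  by apply: contrapT => ne; apply: ng; exists k, c.
have [s0 s0m run] := tow (p x).
have /andP[n0 _] := nP (iter s0 S (p x)).
have N0 : (0 < N)%N by rewrite muln_gt0.
have [r [k [rN rk]]] := near_multiple N0 n0.
(* A run of [n] starts at [s0]; after [r < N] further steps [n] is within 1/2 of a multiple of [N],
   and the remaining run still contains a whole block. *)
pose s := (s0 + r)%N.
have sH : (s <= H)%N by rewrite /s /H; rewrite /N in rN; lia.
have gF w (l : 'I_m) c : p w = p x ->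
    g c (iter (s + 2 * l) T w) = F (l, c) (iter (H - s) T' w).
  move=> pw; have lm := ltn_ord l.
  have rl4 : (r + 2 * l < 4 * m)%N by rewrite /N in rN; lia.
  have nE : n (p (iter (s + 2 * l) T w)) =
      n (iter s0 S (p x)) + r%:R + (2 * l)%:R.
    by rewrite iter_factor pw /s -addnA run// natrD addrA.
  pose i0 := (k * m + l)%N.
  have near_i0 : `|n (p (iter (s + 2 * l) T w)) - (2 * i0)%:R| <= 1 / 2.
    rewrite nE; have -> : (2 * i0)%:R = (k * N)%:R + (2 * l)%:R :> R.
      by rewrite -natrD; congr (_%:R); rewrite /i0 /N; lia.
    by rewrite opprD addrACA subrr addr0.
  (* The bound [n <= P] keeps the required bump among the finitely many available. *)
  have iP : (i0 < P.+1)%N.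
    rewrite ltnS -(ler_nat R).
    have /andP[_ nPw] := nP (p (iter (s + 2 * l) T w)).
    move: near_i0 nPw; rewrite ler_norml natrM => /andP[h1 h2] h3.
    have := ler0n R P; move: h1 h2 h3; move: (n _) => w1 h1 h2 h3 P0.
    have : i0%:R < P%:R + 1 :> R by lra.
    by rewrite natr1 ltr_nat ltnS -(ler_nat R).
  have labi : lab i0 = l by apply: val_inj; rewrite /= /i0 modnMDl modn_small.
  rewrite (gG (Ordinal iP)); last exact: tent_eq1.
  rewrite /G labi; congr (F _ _).
  have -> : (2 * l + H = (H - s) + (s + 2 * l))%N by lia.
  by rewrite iterD (iter_cancel _ TK).
(* All [m * d] coordinates agree at the two points moved back by [H - s]; following the common
   member for [H - s] steps returns to [x] and [y], which must then be closer than [dl]. *)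
have [||V Vb [Vx Vy]] := Finj (iter (H - s) T' x) (iter (H - s) T' y).
- rewrite card_prod !card_ord.
  have := bm (iter (H - s) T' x); have := bm (iter (H - s) T' y).
  move=> hy hx; rewrite (mulnC m d) -leq_double doubleD -[leqRHS]addnn.
  exact: leq_add.
- by move=> [l c]; rewrite -!gF.
- have [|+ _] := bP V _ _ (H - s)%N Vb Vx Vy; first by rewrite /H; lia.
  by rewrite !(iter_cancel _ T'K) ltNge xy.
Qed.

Lemma exists_fiber_separating : exists f : 'I_d -> X -> R, cfam f /\
  forall x y, p x = p y -> x <> y -> exists n c, f c (iter n T x) <> f c (iter n T y).
Proof.
pose Q (f : 'I_d -> X -> R) (w : X * X) :=
  exists n c, f c (iter n T w.1) - f c (iter n T w.2) <> 0.
(* Being in one fibre is written as a closed condition, which makes [K n] compact. *)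
pose K n := [set w : X * X | n.+1%:R^-1 <= mdist w.1 w.2 :> R] `&`
  [set w | mdist (p w.1) (p w.2) <= 0 :> R].
have oQ : jointly_open Q.
  apply: jointly_open_ex => n; apply: jointly_open_ex => c; apply: jointly_open_neq0.
  - move=> f cf w; apply: cvgB.
      apply: (@continuous_comp _ _ _ fst (fun z => f c (iter n T z))).
        exact: cvg_fst.
      exact: continuous_orbit.
    apply: (@continuous_comp _ _ _ snd (fun z => f c (iter n T z))).
      exact: cvg_snd.
    exact: continuous_orbit.
  - move=> f g e w fg; have := fg c (iter n T w.1); have := fg c (iter n T w.2).
    rewrite !ler_norml => /andP[? ?] /andP[? ?]; apply/andP; split; lra.
have cK n : compact (K n).
  have cXX : compact [set: X * X] by rewrite -setXTT; exact: compact_setX.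
  apply: (subclosed_compact _ cXX) => //; apply: closedI.
    exact: (closed_comp (fun x _ => @continuous_mdist2 R X x) (@closed_ge R _)).
  have cpp : continuous (fun w : X * X => (p w.1, p w.2)).
    move=> w; apply: cvg_pair.
      by apply: (@continuous_comp _ _ _ fst p); [exact: cvg_fst | exact: cp].
    by apply: (@continuous_comp _ _ _ snd p); [exact: cvg_snd | exact: cp].
  have cd : continuous (fun w : X * X => mdist (p w.1) (p w.2) : R).
    move=> w; apply: (@continuous_comp _ _ _ (fun w : X * X => (p w.1, p w.2))
      (fun w => mdist w.1 w.2 : R)); [exact: cpp | exact: continuous_mdist2].
  exact: (closed_comp (fun x _ => cd x) (@closed_le R 0)).
have cf0 : @cfam R X d (fun _ _ => 0) by move=> c x; exact: cvg_cst.
have [n|n|f [cf _ Gf]] := @isdense_bigcap R X d (fun n f => forall w, K n w -> Q f w)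
  _ _ (fun _ _ => 0) 1 cf0 ltr01.
- exact: isopen_compact.
- have n0 : 0 < n.+1%:R^-1 :> R by rewrite invr_gt0 ltr0n.
  move=> f e cf e0; have [g [cg fg gP]] := isdense_fiber n0 cf e0.
  exists g; split=> // -[x y] [/= xy pxy].
  have [|k [c gk]] := gP x y _ xy.
    by apply: (@mdist_positivity R); apply/eqP; rewrite eq_le pxy mdist_ge0.
  by exists k, c => /eqP; rewrite subr_eq0 => /eqP.
exists f; split=> // x y pxy xy.
have [|n nlt] := @ltr_add_invr R 0 (mdist x y); first by rewrite mdist_gt0; exact/eqP.
rewrite add0r in nlt.
have [|k [c fk]] := Gf n (x, y); first by split; [exact: ltW|rewrite /= pxy mdistxx].
by exists k, c => E; apply: fk; rewrite /= E subrr.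
Qed.

End fibers.

Lemma dim_lt_top_dim (R : realType) (Z : metricType R) : [set: Z] !=set0 ->
  (top_dim R Z < +oo)%E -> exists D, dim_lt Z D.
Proof.
move=> Z0 dimZ.
have [r rP] : exists r : R, (top_dim R Z <= r%:E)%E.
  case: (top_dim R Z) dimZ => [r _|//|_]; first by exists r.
  by exists 0; rewrite leNye.
exists (Num.bound `|r|).+1 => a ca.
have [n [an [b [cb ba bn]] _]] := cover_dim_natE Z0 ca.
exists b; split=> // z; rewrite (leq_trans (bn z))// ltnS -(ler_nat R).
have nr : n%:R <= r.
  rewrite -lee_fin -an; apply: le_trans rP.
  by apply: ereal_sup_ubound; exists a.
rewrite (le_trans nr)// (le_trans (ler_norm r))// ltW//.
exact: archi_boundP.
Qed.

Theorem mainTheorem4 (R : realType) (d : nat) (X Z : metricType R)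
    (T : X -> X) (S : Z -> Z)
    (hd : (1 <= d)%N)
    (X0 : [set: X] !=set0) (cX : compact [set: X]) (hT : homeomorphism T)
    (cZ : compact [set: Z]) (hS : homeomorphism S)
    (dimZ : (top_dim R Z < +oo)%E) (apS : aperiodic S)
    (ext : is_extension T S)
    (mdimT : (mdim R T < (d%:R / 16)%:E)%E) :
  embeds T (@full_shift R d.+1).
Proof.
have [T' [TK T'K cT cT']] := hT; have [S' [SK S'K cS cS']] := hS.
have [p [cp _ pT]] := ext.
have Z0 : [set: Z] !=set0 by have [x _] := X0; exists (p x).
have [D dimD] := dim_lt_top_dim Z0 dimZ.
have [f [cf fsep]] := exists_fiber_separating cX cZ dimD TK T'K cT cT' SK S'K cS
  cS' apS cp pT (mdim_refinement X0 cT mdimT).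
have c0 : @cfam R Z 1 (fun _ _ => 0) by move=> c x; exact: cvg_cst.
have [h [ch _ hsep]] :=
  isdense_separating cZ dimD SK S'K cS cS' apS c0 ltr01.
pose F (c : 'I_d.+1) x := if unlift ord0 c is Some c' then f c' x else h 0 (p x).
apply: (@embeds_of_separating R X T T' d.+1 cX TK T'K cT cT' F).
  move=> c; rewrite /F; case: (unlift ord0 c) => [c'|]; first exact: cf.
  by move=> x; apply: (@continuous_comp _ _ _ p (h 0)); [exact: cp | exact: ch].
move=> x y Fxy; apply: contrapT => xy.
have [pxy|pxy] := pselect (p x = p y).
  have [n [c]] := fsep x y pxy xy; apply.
  by have := Fxy n (lift ord0 c); rewrite /F liftK.
have [n] := hsep _ _ pxy; apply.
by have := Fxy n ord0; rewrite /F unlift_none !(iter_factor pT).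
Qed.
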